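(* Let $\mathcal{I}$ be any one of $\mathcal{P}$, $\mathcal{P}_\infty$, $\mathcal{B}$. For every $0<\delta\le2$, the isometry class $\{\mu\in\mathcal{I}: X_\mu$ has the LD$\delta$P$\}$ is $G_\delta$-complete in $\mathcal{I}$.
   Context: Coding: $V$ is the set of finitely supported rational sequences; $\mathcal{P}\subset\mathbb{R}^V$ the seminorms on $V$ with pointwise convergence topology; for $\mu\in\mathcal{P}$, $\bar\mu$ is its seminorm extension to $c_{00}$ and $X_\mu$ the completion of $c_{00}/\{\bar\mu=0\}$; $\mathcal{P}_\infty=\{\mu:\dim X_\mu=\infty\}$, $\mathcal{B}=\{\mu\in\mathcal{P}_\infty:\bar\mu$ a norm on $c_{00}\}$, subspace topologies. A Banach space has the LD$\delta$P if every slice $\{x\in B_X:f(x)>1-\alpha\}$ ($f\in S_{X^*}$, $\alpha>0$) of $B_X$ has diameter $\ge\delta$. A set $A$ in a Polish space $Z$ is $G_\delta$-complete if it is $G_\delta$ and every $G_\delta$ subset of every zero-dimensional Polish space is a continuous preimage of $A$. *)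

(* Defs.v *)
From HB Require Import structures.
From mathcomp Require Import all_boot all_order all_algebra.
From mathcomp Require Import all_classical all_reals all_analysis borel_hierarchy.
Set Implicit Arguments. Unset Strict Implicit. Unset Printing Implicit Defensive.
Import Order.TTheory GRing.Theory Num.Theory.
Import numFieldNormedType.Exports.
Local Open Scope classical_set_scope.
Local Open Scope ring_scope.

Definition zero_dim_space (T : topologicalType) : Prop :=
  forall (U : set T) (x : T), open U -> U x ->
    exists C : set T, [/\ clopen C, C x & C `<=` U].

Definition polish_space (R : realType) (T : topologicalType) : Prop :=
  (exists D : set T, countable D /\ dense D) /\
  exists d : T -> T -> R,
    [/\ (forall x y, 0 <= d x y) /\ (forall x y, d x y = 0 <-> x = y),
        forall x y, d x y = d y x,
        forall x y z, d x z <= d x y + d y z,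
        (forall U : set T, open U <->
           (forall x, U x -> exists2 e : R, 0 < e & [set y | d x y < e] `<=` U))
      & (forall u : nat -> T,
           (forall e : R, 0 < e -> exists N : nat, forall m n : nat,
               (N <= m)%N -> (N <= n)%N -> d (u m) (u n) < e) ->
           exists x : T, u @ \oo --> x)].

Definition Gdelta_complete (R : realType) (T : topologicalType) (I : set T)
    (A : set (subspace I)) : Prop :=
  Gdelta A /\
  forall (Y : topologicalType), polish_space R Y -> zero_dim_space Y ->
    forall B : set Y, Gdelta B ->
      exists f : Y -> subspace I,
        [/\ continuous f, forall y, I (f y) & B = f @^-1` A].

(* V = finitely supported rational sequences, represented by their
   coefficient sequences, i.e. as polynomials over rat (p`_i is the
   i-th term; 'X^i is the i-th unit vector). *)
Notation V := {poly rat}.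

Notation RV R := {ptws V -> R}.

Definition Pset (R : realType) : set (RV R) :=
  [set mu | (forall p q : V, mu (p + q) <= mu p + mu q) /\
            (forall (c : rat) (p : V), mu (c *: p) = `|ratr c : R| * mu p)].

(* c00 (finitely supported real sequences) is represented as {poly R}.
   mubar mu is the (unique, continuous) extension of mu from V to c00,
   computed as the limit of mu along coordinatewise rational dyadic-type
   approximations floor((n+1) x_i)/(n+1). *)
Definition approx (R : realType) (n : nat) (x : {poly R}) : V :=
  map_poly (fun r : R => ((Num.floor (r * n.+1%:R))%:~R / n.+1%:R : rat)) x.

Definition mubar (R : realType) (mu : V -> R) (x : {poly R}) : R :=
  limn (fun n => mu (approx n x)).

(* X with j : V -> X is (a model of) the completion X_mu of c00/{mubar = 0}:
   j is Q-linear, isometric (||j p|| = mu p) and has dense range.  Its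
   R-linear extension to c00 then identifies X with X_mu isometrically. *)
Definition is_Xmu (R : realType) (mu : V -> R)
    (X : completeNormedModType R) (j : V -> X) : Prop :=
  [/\ forall p q, j (p + q) = j p + j q,
      forall (c : rat) p, j (c *: p) = ratr c *: j p,
      forall p, `|j p| = mu p
    & dense (range j)].

Definition inf_dim (R : realType) (X : completeNormedModType R) : Prop :=
  forall n : nat, exists v : 'I_n -> X,
    forall a : 'I_n -> R, \sum_(i < n) a i *: v i = 0 -> forall i, a i = 0.

Definition Pinf (R : realType) : set (RV R) :=
  [set mu | Pset mu /\
     forall (X : completeNormedModType R) (j : V -> X), is_Xmu mu j -> inf_dim X].

Definition Bset (R : realType) : set (RV R) :=
  [set mu | Pinf mu /\ forall x : {poly R}, mubar mu x = 0 -> x = 0].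

Definition closed_unit_ball (R : realType) (X : normedModType R) : set X :=
  [set x | `|x| <= 1].

Definition slice (R : realType) (X : normedModType R) (f : X -> R) (alpha : R)
  : set X := [set x | `|x| <= 1 /\ 1 - alpha < f x].

Definition diam (R : realType) (X : normedModType R) (S : set X) : R :=
  sup [set `|x - y| | x in S & y in S].

Definition in_dual_sphere (R : realType) (X : normedModType R) (f : X -> R) : Prop :=
  (forall (a : R) (x y : X), f (a *: x + y) = a * f x + f y) /\
  sup [set `|f x| | x in @closed_unit_ball R X] = 1.

Definition LDP (R : realType) (delta : R) (X : normedModType R) : Prop :=
  forall f : X -> R, in_dual_sphere f ->
    forall alpha : R, 0 < alpha -> delta <= diam (slice f alpha).

Definition Xmu_LDP (R : realType) (delta : R) (mu : V -> R) : Prop :=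
  forall (X : completeNormedModType R) (j : V -> X), is_Xmu mu j -> LDP delta X.

(* Main.v *)
(* By Hahn-Banach, a Banach space X has the LDδP iff, for every e > 0, the
   midpoints m = (u + v) / 2 of pairs in the open unit ball with
   |u - v| > δ - e norm every functional, that is, iff the sublinear functional
     P x = inf { sum_i c_i + 2 |x - sum_i c_i m_i| }  (c_i >= 0)
   satisfies P <= |.|.  For X = X_mu it suffices to use x, u, v in V and rational
   c_i, so that the LDδP becomes a countable intersection of conditions which
   are open in mu.

   For the hardness, let O = ∩_n O_n be a G_δ subset of a metric space Y, and
   t_n(y) = min(1, d(y, Y \ O_n)).  Split N into infinitely many infinite blocks
   and put
     mu_y(x) = sum_n max(sum_{i in block n} 2^-i |x_i|, t_n(y) max_{i in block n} |x_i|).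
   If all t_n(y) are positive, each summand is locally almost square (a suitable
   multiple of a far unit vector changes the norm little but has large norm), and
   subadditivity of P yields the LD2P.  If t_n(y) = 0, the n-th summand is an
   l1-norm, whose coordinate functionals define slices of arbitrarily small
   diameter. *)

Require Import Defs.
From HB Require Import structures.
From mathcomp Require Import all_boot all_order all_algebra.
From mathcomp Require Import all_classical all_reals all_analysis borel_hierarchy.
From mathcomp Require Import ring lra.
Set Implicit Arguments.
Unset Strict Implicit.
Import Order.TTheory GRing.Theory Num.Theory.
Import numFieldNormedType.Exports.
Local Open Scope classical_set_scope.
Local Open Scope ring_scope.

(** * Hahn-Banach for abelian groups *)

(** Homogeneity is asked for natural multiples only, so that a single Hahn-Banach theorem serves
    both the rational space [V] and real Banach spaces. *)
Definition group_sublinear (R : realType) (W : zmodType) (p : W -> R) : Prop :=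
  (forall x y, p (x + y) <= p x + p y) /\
  (forall x n, p (x *+ n) = n%:R * p x).

Section GroupSublinear.
Context {R : realType} {W : zmodType}.
Implicit Types (p q : W -> R) (x y : W).

Lemma group_sublinear0 p : group_sublinear p -> p 0 = 0.
Proof. by case=> _ /(_ 0 0%N); rewrite mulr0n mul0r. Qed.

Lemma group_sublinearN p x : group_sublinear p -> - p (- x) <= p x.
Proof.
move=> pS; have [pD _] := pS.
have := pD x (- x); rewrite subrr (group_sublinear0 pS); lra.
Qed.

(** Half of homogeneity comes for free by induction; the sublinearity proofs for infima below only
    have to supply the reverse inequality. *)
Lemma subadditive_mulrn p x n :
  p 0 = 0 -> (forall x y, p (x + y) <= p x + p y) -> p (x *+ n) <= n%:R * p x.
Proof.
move=> p0 pD; elim: n => [|n IHn]; first by rewrite mulr0n p0 mul0r.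
rewrite mulrSr -natr1 mulrDl mul1r; apply: (le_trans (pD _ _)).
by rewrite lerD2r.
Qed.

(** For sublinear [p] this stays below [p] (term [n = 0]) and is at most [- p y] at [- y] (term
    [n = 1]), which forces additive functionals below it to agree with [p] at [y]. *)
Definition tilt p y : W -> R :=
  fun x => inf (range (fun n : nat => p (x + y *+ n) - n%:R * p y)).

Lemma tilt_lb p y x : group_sublinear p ->
  lbound (range (fun n : nat => p (x + y *+ n) - n%:R * p y)) (- p (- x)).
Proof.
move=> [pD pM] _ [n _ <-].
have := pD (x + y *+ n) (- x); rewrite addrAC subrr add0r pM; lra.
Qed.

Lemma tilt_le p y x n : group_sublinear p ->
  tilt p y x <= p (x + y *+ n) - n%:R * p y.
Proof.
move=> pS; apply: ge_inf; last by exists n.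
by exists (- p (- x)); exact: tilt_lb.
Qed.

Lemma le_tilt p y x c :
  (forall n, c <= p (x + y *+ n) - n%:R * p y) -> c <= tilt p y x.
Proof.
move=> h; apply: lb_le_inf; first by exists (p (x + y *+ 0) - 0%:R * p y), 0%N.
by move=> _ [n _ <-].
Qed.

Lemma tilt_sublinear p y : group_sublinear p -> group_sublinear (tilt p y).
Proof.
move=> pS; have [pD pM] := pS.
have tD a b : tilt p y (a + b) <= tilt p y a + tilt p y b.
  rewrite -lerBlDl; apply: le_tilt => m.
  suff : tilt p y (a + b) - (p (b + y *+ m) - m%:R * p y) <= tilt p y a by lra.
  apply: le_tilt => n.
  have := tilt_le y (a + b) (n + m) pS.
  have := pD (a + y *+ n) (b + y *+ m).
  rewrite mulrnDr natrD mulrDl [a + b + _]addrACA; lra.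
have t0 : tilt p y 0 = 0.
  apply/eqP; rewrite eq_le; apply/andP; split.
    have := tilt_le y 0 0 pS.
    by rewrite mulr0n addr0 (group_sublinear0 pS) mul0r subrr.
  by apply: le_tilt => n; rewrite add0r pM subrr.
split=> // x k; apply/eqP; rewrite eq_le subadditive_mulrn//=.
case: k => [|k]; first by rewrite mulr0n t0 mul0r.
apply: le_tilt => n.
(* [(x + y *+ n) *+ k.+1] is [x *+ k.+1 + y *+ n] plus [k * n] further copies of [y], which cost at
   most [k * n] times [p y]. *)
have k0 : 0 <= k.+1%:R :> R by [].
have := ler_wpM2l k0 (tilt_le y x n pS).
rewrite mulrBr -(pM (x + y *+ n)) mulrnDl.
have := pD (x *+ k.+1 + y *+ n) (y *+ n *+ k).
rewrite -addrA -mulrS !pM -[k.+1%:R]natr1; nra.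
Qed.

(** Provides the bound of a chain for Zorn's lemma. The infimum is finite since each member is at
    least [- p (- x)] at [x]; it is subadditive since bounds through two members can be combined at
    the smaller one. *)
Lemma group_sublinear_inf p (A : set (W -> R)) :
  group_sublinear p -> A !=set0 ->
  (forall q, A q -> group_sublinear q /\ forall x, q x <= p x) ->
  (forall q r, A q -> A r -> (forall x, q x <= r x) \/ (forall x, r x <= q x)) ->
  [/\ group_sublinear (fun x => inf [set q x | q in A]),
      forall x, inf [set q x | q in A] <= p x
    & forall q x, A q -> inf [set q x | q in A] <= q x].
Proof.
move=> pS [q0 Aq0] AS Atot; set f := fun x => inf _.
have lb q x : A q -> f x <= q x.
  move=> Aq; apply: ge_inf; last by exists q.
  exists (- p (- x)) => _ [r Ar <-].
  have [rS rp] := AS _ Ar.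
  by have := group_sublinearN x rS; have := rp (- x); lra.
have glb x c : (forall q, A q -> c <= q x) -> c <= f x.
  move=> h; apply: lb_le_inf; first by exists (q0 x), q0.
  by move=> _ [q Aq <-]; exact: h.
have f0 : f 0 = 0.
  apply/eqP; rewrite eq_le; apply/andP; split.
    by have := lb _ 0 Aq0; rewrite (group_sublinear0 (AS _ Aq0).1).
  by apply: (glb _ _ _) => q /AS[qS _]; rewrite (group_sublinear0 qS).
have fD x y : f (x + y) <= f x + f y.
  rewrite -lerBlDl; apply: (glb _ _ _) => q Aq.
  suff : f (x + y) - q y <= f x by lra.
  apply: (glb _ _ _) => r Ar.
  have [|] := Atot _ _ Aq Ar => [qr|rq].
    by have := lb _ (x + y) Aq; have := (AS _ Aq).1.1 x y; have := qr x; lra.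
  by have := lb _ (x + y) Ar; have := (AS _ Ar).1.1 x y; have := rq y; lra.
split=> //; last by move=> x; apply: (le_trans (lb _ _ Aq0)); exact: (AS _ Aq0).2.
split=> // x n; apply/eqP; rewrite eq_le subadditive_mulrn//=.
apply: (glb _ _ _) => q Aq; rewrite (AS _ Aq).1.2; apply: ler_wpM2l => //; exact: lb.
Qed.

Lemma minimal_sublinear p : group_sublinear p ->
  exists f, [/\ group_sublinear f, forall x, f x <= p x
    & forall g, group_sublinear g -> (forall x, g x <= f x) -> g = f].
Proof.
move=> pS.
pose T := {q : W -> R | group_sublinear q /\ forall x, q x <= p x}.
(* The pointwise order is reversed, so that the maximal element given by Zorn's lemma is a minimal
   functional. *)
pose leT (q r : T) := `[< forall x, sval r x <= sval q x >].
have [] := @Zorn T leT.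
- by move=> q; apply/asboolP.
- move=> q r s /asboolP qr /asboolP rs; apply/asboolP => x.
  exact: le_trans (rs x) (qr x).
- move=> q r /asboolP qr /asboolP rq.
  apply: eq_sig_hprop => /=; first by move=> ? ? ?; exact: Prop_irrelevance.
  by apply/funext => x; apply/eqP; rewrite eq_le qr rq.
- move=> A Atot.
  have [->|/set0P[q0 Aq0]] := eqVneq A set0.
    by exists (exist _ p (conj pS (fun=> lexx _))).
  have [|||fS fp flb] := @group_sublinear_inf p [set sval q | q in A] pS.
  + by exists (sval q0), q0.
  + by move=> _ [q _ <-]; exact: (svalP q).
  + move=> _ _ [q Aq <-] [r Ar <-].
    by have [/asboolP|/asboolP] := Atot _ _ Aq Ar; [right|left].
  pose t : T := exist (fun q => group_sublinear q /\ forall x, q x <= p x) _ (conj fS fp).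
  exists t => q Aq; apply/asboolP => x.
  by apply: flb; exists q.
move=> [f [fS fp]] fmin; exists f; split => // g gS gf.
have gp x : g x <= p x by exact: le_trans (gf x) (fp x).
pose t : T := exist (fun q => group_sublinear q /\ forall x, q x <= p x) g (conj gS gp).
by apply: (congr1 sval (fmin t _)); exact/asboolP.
Qed.

(* A minimal sublinear functional is additive, because tilting cannot decrease it. *)
Lemma hahn_banach p x0 : group_sublinear p ->
  exists f : W -> R, [/\ forall x y, f (x + y) = f x + f y,
    forall x, f x <= p x & f x0 = p x0].
Proof.
move=> pS.
(* Minimality is taken below [tilt p x0] instead of [p]: then [f (- x0) <= - p x0], and additivity
   turns this into [f x0 = p x0]. *)
have [f [fS fle fmin]] := minimal_sublinear (tilt_sublinear x0 pS).
have tilt0 q x y : group_sublinear q -> tilt q y x <= q x.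
  by move=> qS; have := tilt_le y x 0 qS; rewrite mulr0n addr0 mul0r subr0.
have fD x y : f (x + y) = f x + f y.
  apply/eqP; rewrite eq_le fS.1/=.
  have <- := fmin _ (tilt_sublinear y fS) (fun x => tilt0 f x y fS).
  have := tilt_le y x 1 fS; rewrite mulr1n mul1r.
  have tE := fmin _ (tilt_sublinear y fS) (fun x => tilt0 f x y fS).
  by rewrite tE; lra.
have fp x : f x <= p x by apply: le_trans (fle x) (tilt0 _ _ _ pS).
exists f; split => //; apply/eqP; rewrite eq_le fp/=.
have := fle (- x0); have := tilt_le x0 (- x0) 1 pS.
rewrite mulr1n addNr mul1r (group_sublinear0 pS).
have := fD x0 (- x0); rewrite subrr (group_sublinear0 fS); lra.
Qed.

End GroupSublinear.

(** * Completion of a rational seminorm *)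

Definition rat_seminorm (R : realType) (W : lmodType rat) (mu : W -> R) : Prop :=
  (forall x y, mu (x + y) <= mu x + mu y) /\
  (forall (c : rat) x, mu (c *: x) = `|ratr c : R| * mu x).

Section RatSeminorm.
Context {R : realType} {W : lmodType rat} {mu : W -> R}.
Hypothesis muS : rat_seminorm mu.

Lemma rat_seminormN x : mu (- x) = mu x.
Proof. by rewrite -scaleN1r muS.2 rmorphN1 normrN normr1 mul1r. Qed.

Lemma rat_seminorm0 : mu 0 = 0.
Proof. by rewrite -(scale0r 0) muS.2 rmorph0 normr0 mul0r. Qed.

Lemma rat_seminorm_ge0 x : 0 <= mu x.
Proof.
by have := muS.1 x (- x); rewrite subrr rat_seminorm0 rat_seminormN; lra.
Qed.

Lemma rat_seminorm_group_sublinear : group_sublinear mu.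
Proof.
split; first exact: muS.1.
by move=> x n; rewrite -scaler_nat muS.2 ratr_nat ger0_norm.
Qed.

End RatSeminorm.

Section AdditiveFunctional.
Context {R : realType} {W : lmodType rat} {phi : W -> R}.
Hypothesis phiD : forall x y, phi (x + y) = phi x + phi y.

Lemma additive0 : phi 0 = 0.
Proof. by have := phiD 0 0; rewrite addr0; lra. Qed.

Lemma additiveN x : phi (- x) = - phi x.
Proof. by have := phiD x (- x); rewrite subrr additive0; lra. Qed.

Lemma additive_mulrn x n : phi (x *+ n) = n%:R * phi x.
Proof.
elim: n => [|n IHn]; first by rewrite mulr0n additive0 mul0r.
by rewrite mulrSr phiD IHn -natr1 mulrDl mul1r.
Qed.

Lemma additive_ratZ c x : phi (c *: x) = ratr c * phi x.
Proof.
have d0 : (denq c)%:~R != 0 :> R by rewrite intr_eq0 denq_neq0.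
apply: (mulfI d0).
have phiZ (z : int) y : phi (y *~ z) = z%:~R * phi y.
  case: z => n; first by rewrite -pmulrn additive_mulrn.
  by rewrite NegzE mulrNz -pmulrn additiveN additive_mulrn mulrNz mulNr.
rewrite -phiZ -scaler_int scalerA.
have -> : (denq c)%:~R * c = (numq c)%:~R :> rat by rewrite mulrC numqE.
by rewrite scaler_int phiZ mulrA /ratr mulrCA mulfV ?mulr1.
Qed.

End AdditiveFunctional.

(** Additivity already implies rational linearity, and applying the one-sided bound to [- x] as well
    yields [|phi x| <= mu x]. *)
Definition dual_ball (R : realType) (W : lmodType rat) (mu : W -> R) : Type :=
  {phi : W -> R | (forall x y, phi (x + y) = phi x + phi y) /\
                  forall x, phi x <= mu x}.

(* The completion is realized inside the bounded functions on the dual ball, as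
   the uniform closure of the evaluations at points of [W]. *)
Definition uniform_limit_of_evaluations (R : realType) (W : lmodType rat)
    (mu : W -> R) (muS : rat_seminorm mu) : {pred (dual_ball mu -> R^o)} :=
  fun F => `[< forall e : R, 0 < e ->
                 exists p, forall phi, `|F phi - sval phi p| <= e >].

Section Completion.
Context {R : realType} {W : lmodType rat} {mu : W -> R}.
Hypothesis muS : rat_seminorm mu.

Lemma dual_ball_norm (phi : dual_ball mu) x : `|sval phi x| <= mu x.
Proof.
have [phiD phile] := svalP phi.
rewrite ler_norml phile andbT lerNl -(additiveN phiD).
by rewrite -(rat_seminormN muS).
Qed.

Fact uniform_limit_submod_closed :
  submod_closed (uniform_limit_of_evaluations muS).
Proof.
split.
  apply/asboolP => e e0; exists 0 => phi.
  by rewrite (additive0 (svalP phi).1) subr0 normr0 ltW.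
move=> a F G /asboolP hF /asboolP hG; apply/asboolP => e e0.
(* Evaluations form only a rational space, so the real scalar [a] is replaced by a rational [c].
   First [p] is chosen, with an error that survives multiplication by [a]; then [c], with a
   precision depending on [mu p]. *)
have [p hp] : exists p, forall phi, `|F phi - sval phi p| <= e / 3 / (1 + `|a|).
  by apply: hF; rewrite !divr_gt0// ltr_pwDl.
have [q hq] := hG (e / 3) ltac:(by rewrite divr_gt0).
have mup : 0 <= mu p by exact: rat_seminorm_ge0.
have d0 : 0 < e / 3 / (1 + mu p) by rewrite !divr_gt0// ltr_pwDl.
have [c] : exists c, ratr c \in `]a - e / 3 / (1 + mu p), a + e / 3 / (1 + mu p)[.
  by apply: rat_in_itvoo; lra.
rewrite in_itv/= => /andP[c1 c2].
exists (c *: p + q) => phi.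
have [phiD _] := svalP phi.
rewrite phiD (additive_ratZ phiD).
set f : R := F phi; set g : R := G phi.
rewrite -[(a *: F + G) phi]/(a * f + g).
have -> : a * f + g - (ratr c * sval phi p + sval phi q) =
  a * (f - sval phi p) + (a - ratr c) * sval phi p + (g - sval phi q) by ring.
apply: (le_trans (ler_normD _ _)).
apply: (@le_trans _ _ (e / 3 + e / 3 + e / 3)); last by lra.
apply: lerD; last exact: hq.
apply: (le_trans (ler_normD _ _)); apply: lerD.
  rewrite normrM; apply: (le_trans (ler_wpM2l (normr_ge0 a) (hp phi))).
  rewrite mulrA ler_pdivrMr ?ltr_pwDl// mulrC.
  by apply: ler_wpM2l; [lra|rewrite lerDr].
rewrite normrM.
have ac : `|a - ratr c| <= e / 3 / (1 + mu p) by rewrite ler_norml; lra.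
apply: (le_trans (ler_pM _ _ ac (dual_ball_norm phi p))) => //.
rewrite mulrAC ler_pdivrMr ?ltr_pwDl//.
by apply: ler_wpM2l; [lra|rewrite lerDr].
Qed.

HB.instance Definition _ :=
  GRing.isSubmodClosed.Build R (dual_ball mu -> R^o)
    (uniform_limit_of_evaluations muS) uniform_limit_submod_closed.

Definition completion : Type :=
  {F : dual_ball mu -> R^o | F \in uniform_limit_of_evaluations muS}.

HB.instance Definition _ := SubType.on completion.
HB.instance Definition _ := Choice.on completion.
HB.instance Definition _ := [SubChoice_isSubLmodule of completion by <:].

(** Ensures that the supremum in [completion_norm] is taken over a nonempty set. *)
Definition zero_functional : dual_ball mu :=
  exist _ (fun=> 0) (conj (fun _ _ => esym (addr0 0)) (rat_seminorm_ge0 muS)).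

Definition completion_norm (F : completion) : R :=
  sup (range (fun phi => `|val F phi : R|)).

Lemma completion_norm_ubound (F : completion) :
  has_ubound (range (fun phi => `|val F phi : R|)).
Proof.
have /asboolP/(_ 1 ltr01)[p hp] := valP F.
exists (1 + mu p) => _ [phi _ <-].
rewrite -(subrK (sval phi p) (val F phi : R)).
apply: (le_trans (ler_normD _ _)); apply: lerD; first exact: hp.
exact: dual_ball_norm.
Qed.

Lemma ler_completion_norm (F : completion) phi :
  `|val F phi : R| <= completion_norm F.
Proof. by apply: ub_le_sup; [exact: completion_norm_ubound|exists phi]. Qed.

Lemma completion_norm_le (F : completion) c :
  (forall phi, `|val F phi : R| <= c) -> completion_norm F <= c.
Proof.
move=> h; apply: ge_sup; last by move=> _ [phi _ <-].
by exists `|val F zero_functional : R|, zero_functional.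
Qed.

Fact completion_normD (F G : completion) :
  completion_norm (F + G) <= completion_norm F + completion_norm G.
Proof.
apply: completion_norm_le => phi.
rewrite -[val (F + G) phi]/((val F phi : R) + (val G phi : R)).
by apply: (le_trans (ler_normD _ _)); apply: lerD; exact: ler_completion_norm.
Qed.

Fact completion_normZ (a : R) (F : completion) :
  completion_norm (a *: F) = `|a| * completion_norm F.
Proof.
have le_normZ b G : completion_norm (b *: G) <= `|b| * completion_norm G.
  apply: completion_norm_le => phi.
  rewrite -[val (b *: G) phi]/(b * (val G phi : R)) normrM.
  by apply: ler_wpM2l => //; exact: ler_completion_norm.
apply/eqP; rewrite eq_le le_normZ /=.
have [->|a0] := eqVneq a 0.
  rewrite normr0 mul0r.
  exact: le_trans (normr_ge0 _) (ler_completion_norm _ zero_functional).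
rewrite -ler_pdivlMl ?normr_gt0// -normfV.
by rewrite -{1}[F](scalerK a0) le_normZ.
Qed.

Fact completion_norm0_eq0 (F : completion) : completion_norm F = 0 -> F = 0.
Proof.
move=> F0; apply/val_inj/funext => phi.
by apply/eqP; rewrite -[_ == _]normr_le0 -F0; exact: ler_completion_norm.
Qed.

HB.instance Definition _ := Lmodule_isNormed.Build R completion
  completion_normD completion_normZ completion_norm0_eq0.

Lemma completion_normB_le (F G : completion) phi :
  `|(val F phi : R) - (val G phi : R)| <= `|F - G|.
Proof. exact: (ler_completion_norm (F - G)). Qed.

(** The limit is formed pointwise on the dual ball. The Cauchy condition is uniform in [phi], so
    convergence is uniform and the limit is again approximated by evaluations. *)
Lemma completion_cauchy_cvg (Fl : set_system completion) :
  ProperFilter Fl -> cauchy Fl -> cvg Fl.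
Proof.
move=> PF cF.
have near_pt (e : R) : 0 < e -> exists G : completion, \forall x \near Fl, `|G - x| < e.
  move=> e0; have /cauchyP/(_ e e0)[G FG] := cF.
  by exists G; move: FG; rewrite -ball_normE.
pose ev phi (x : completion) : R := val x phi.
have cv phi : cvg (ev phi @ Fl).
  apply: cauchy_cvg; apply/cauchyP => e e0.
  have [G nG] := near_pt e e0.
  exists (ev phi G); rewrite -ball_normE; apply: filterS nG => x /=.
  by apply: le_lt_trans; exact: completion_normB_le.
pose L phi : R^o := lim (ev phi @ Fl).
have L_le e (G : completion) : (\forall x \near Fl, `|G - x| < e) ->
    forall phi, `|(val G phi : R) - L phi| <= e.
  move=> nG phi; rewrite distrC.
  have cvL : ev phi @ Fl --> (L phi : R) by exact: cv.
  have cvN : (fun x => `|ev phi x - ev phi G|) @ Fl --> `|(L phi : R) - ev phi G|.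
    by apply: cvg_norm; apply: cvgB => //; exact: cvg_cst.
  apply: (ler_cvg_to cvN (cvg_cst e)); apply: filterS nG => x hx.
  rewrite distrC; apply: le_trans (ltW hx); exact: completion_normB_le.
have Lp : L \in uniform_limit_of_evaluations muS.
  apply/asboolP => e e0.
  have [G /L_le GL] := near_pt (e / 2) ltac:(by rewrite divr_gt0).
  have /asboolP/(_ (e / 2))[|p hp] := valP G; first by rewrite divr_gt0.
  exists p => phi; have := hp phi; have := GL phi.
  rewrite !ler_norml; lra.
apply/cvg_ex; exists (exist _ L Lp : completion).
apply/cvgrPdist_le => e e0.
have [G nG] := near_pt (e / 2) ltac:(by rewrite divr_gt0).
have GL := L_le _ _ nG.
apply: filterS nG => x hx.
apply: completion_norm_le => phi.
rewrite -[val _ phi]/((L phi : R) - (val x phi : R)).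
have := GL phi; have := le_lt_trans (completion_normB_le G x phi) hx.
rewrite ltr_norml !ler_norml; lra.
Qed.

HB.instance Definition _ := Uniform_isComplete.Build completion
  completion_cauchy_cvg.

Fact evaluation_subproof p :
  (fun phi : dual_ball mu => sval phi p : R^o)
    \in uniform_limit_of_evaluations muS.
Proof.
by apply/asboolP => e e0; exists p => phi; rewrite subrr normr0 ltW.
Qed.

Definition evaluation p : completion :=
  exist (fun F => F \in uniform_limit_of_evaluations muS) _ (evaluation_subproof p).

(* Hahn-Banach makes the embedding isometric. *)
Lemma norm_evaluation p : `|evaluation p| = mu p.
Proof.
apply/eqP; rewrite eq_le; apply/andP; split.
  by apply: completion_norm_le => phi; exact: dual_ball_norm.
have [f [fD fle fp]] := hahn_banach p (rat_seminorm_group_sublinear muS).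
rewrite -fp; apply: le_trans (ler_norm _) _.
exact: (ler_completion_norm (evaluation p) (exist _ f (conj fD fle))).
Qed.

End Completion.

(** [Xmu_LDP] quantifies over all models of the completion; the existence of one keeps it from
    holding vacuously. *)
Theorem completion_exists (R : realType) (mu : V -> R) : Pset mu ->
  exists (X : completeNormedModType R) (j : V -> X), is_Xmu mu j.
Proof.
move=> muS; exists (completion muS : completeNormedModType R), (evaluation muS).
split.
- by move=> p q; apply/val_inj/funext => phi; exact: (svalP phi).1.
- move=> c p; apply/val_inj/funext => phi.
  exact: (additive_ratZ (svalP phi).1).
- exact: norm_evaluation.
- move=> U [F UF] oU.
  have /nbhs_ballP[e e0 eU] : nbhs F U by apply: open_nbhs_nbhs.
  have /asboolP/(_ (e / 2))[|p hp] := valP F; first by rewrite divr_gt0.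
  exists (evaluation muS p); split; last by exists p.
  apply: eU; rewrite -ball_normE /=.
  apply: (@le_lt_trans _ _ (e / 2)); last by rewrite gtr_pMr// invf_lt1// ltr1n.
  exact: completion_norm_le.
Qed.

(** * A dual-free form of the LDδP *)

Section Cost.
Context {R : realType} {W : lmodType rat}.
Implicit Types (mu : W -> R) (d : R) (l : seq (rat * W * W)).

(* An entry [(c, u, v)] stands for [c] times the midpoint [(u + v) / 2]. *)
Fixpoint cost (U : zmodType) (nrm : U -> R) (j : W -> U) l (x : U) : R :=
  if l is (c, u, v) :: l' then
    ratr c + cost nrm j l' (x - j ((c / 2) *: (u + v)))
  else 2 * nrm x.

(** Every inequality involving [mu] is strict, which makes admissibility of a fixed list an open
    condition on [mu]. *)
Fixpoint admissible mu d l : Prop :=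
  if l is (c, u, v) :: l' then
    [/\ 0 <= c, mu u < 1, mu v < 1 & d < mu (u - v)] /\ admissible mu d l'
  else True.

Lemma admissible_cat mu d l l' :
  admissible mu d l -> admissible mu d l' -> admissible mu d (l ++ l').
Proof. by elim: l => //= -[[c u] v] l IHl [? /IHl h] /h. Qed.

Definition rescale (n : nat) l : seq (rat * W * W) :=
  [seq (t.1.1 / n%:R, t.1.2, t.2) | t <- l].

Lemma admissible_rescale mu d n l :
  admissible mu d l -> admissible mu d (rescale n l).
Proof.
elim: l => //= -[[c u] v] l IHl /= [[c0 hu hv uv] /IHl hl]; split => //.
by split => //; rewrite divr_ge0.
Qed.

Section CostSeminorm.
Context {U : zmodType} {nrm : U -> R} {j : W -> U}.
Hypothesis nrmS : group_sublinear nrm.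
Hypothesis jD : forall x y, j (x + y) = j x + j y.

Lemma cost_lipschitz l x y : cost nrm j l (x + y) <= 2 * nrm x + cost nrm j l y.
Proof.
elim: l x y => [|[[c u] v] l IHl] x y /=; first by have := nrmS.1 x y; lra.
by have := IHl x (y - j ((c / 2) *: (u + v))); rewrite addrA; lra.
Qed.

(** Joining two combinations represents the sum of their points; this is the source of the
    subadditivity of [cost_inf]. *)
Lemma cost_cat l l' x y :
  cost nrm j (l ++ l') (x + y) <= cost nrm j l x + cost nrm j l' y.
Proof.
elim: l x => [|[[c u] v] l IHl] x /=; first exact: cost_lipschitz.
by have := IHl (x - j ((c / 2) *: (u + v))); rewrite addrAC; lra.
Qed.

(** A combination for [x *+ n] divided by [n] is one for [x]; this is the source of the homogeneity
    of [cost_inf]. *)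
Lemma cost_rescale l x n : (0 < n)%N ->
  cost nrm j l (x *+ n) = n%:R * cost nrm j (rescale n l) x.
Proof.
move=> n0; have nz : n%:R != 0 :> rat by rewrite pnatr_eq0 -lt0n.
elim: l x => [|[[c u] v] l IHl] x /=; first by rewrite nrmS.2 mulrCA.
have jn z m : j (z *+ m) = j z *+ m.
  elim: m => [|m IHm]; last by rewrite !mulrSr jD IHm.
  by rewrite !mulr0n; apply: (addrI (j 0)); rewrite -jD !addr0.
rewrite mulrDr -IHl mulrnBl -jn.
rewrite -[_ *: (u + v) *+ n]scaler_nat scalerA.
have -> : n%:R * (c / n%:R / 2) = c / 2 by field.
rewrite fmorph_div /= ratr_nat mulrCA mulfV ?mulr1//.
by rewrite pnatr_eq0 -lt0n.
Qed.

Lemma cost_ge0 mu d l x :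
  (forall y, 0 <= nrm y) -> admissible mu d l -> 0 <= cost nrm j l x.
Proof.
move=> nrm0; elim: l x => [|[[c u] v] l IHl] x /=.
  by move=> _; rewrite mulr_ge0.
by move=> [[c0 _ _ _] /IHl h]; rewrite addr_ge0// ler0q.
Qed.

End CostSeminorm.

(** Each midpoint contributes at most [1 - b] per unit of coefficient, and the remainder is absorbed
    by the factor 2 in [cost], because [2 * (1 - b) >= 1]. *)
Lemma cost_functional_bound (phi mu : W -> R) d b l x :
  (forall x y, phi (x + y) = phi x + phi y) ->
  (forall x, 0 <= mu x) -> (forall x, phi x <= mu x) ->
  0 <= b <= 1 / 2 ->
  (forall u v, mu u < 1 -> mu v < 1 -> d < mu (u - v) ->
     phi u + phi v <= 2 * (1 - b)) ->
  admissible mu d l -> phi x <= (1 - b) * cost mu id l x.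
Proof.
move=> phiD mu0 phile b2 hphi; elim: l x => [|[[c u] v] l IHl] x /=.
  by move=> _; have := phile x; have := mu0 x; nra.
move=> [[c0 hu hv uv] /IHl h].
have := h (x - (c / 2) *: (u + v)).
rewrite phiD (additiveN phiD) (additive_ratZ phiD) phiD.
rewrite fmorph_div /= (rmorph_nat (ratr : rat -> R) 2) /=.
have c0' : 0 <= ratr c :> R by rewrite ler0q.
by have := hphi u v hu hv uv; nra.
Qed.

End Cost.

(** The inequality between P and [mu] without an infimum: the index [k] controls both the loss in
    [delta] and the accuracy of the approximation. *)
Definition LD_condition (R : realType) (W : lmodType rat) (delta : R)
    (mu : W -> R) : Prop :=
  forall (k : nat) x, exists l, admissible mu (delta - k.+1%:R^-1) l /\
    cost mu id l x < mu x + k.+1%:R^-1.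

Section CostInf.
Context {R : realType} {W : lmodType rat} {U : zmodType}.
Variables (mu : W -> R) (d : R) (nrm : U -> R) (j : W -> U).
Hypothesis nrmS : group_sublinear nrm.
Hypothesis nrm0 : forall y, 0 <= nrm y.
Hypothesis jD : forall x y, j (x + y) = j x + j y.

(** The sublinear functional P. It is used on the completion, with [j] the embedding of [V], and on
    [V] itself, with [j] the identity. *)
Definition cost_inf (x : U) : R :=
  inf [set cost nrm j l x | l in admissible mu d].

Lemma cost_inf_le l x : admissible mu d l -> cost_inf x <= cost nrm j l x.
Proof.
move=> hl; apply: ge_inf; last by exists l.
by exists 0 => _ [l' hl' <-]; exact: cost_ge0 hl'.
Qed.

Lemma le_cost_inf c x :
  (forall l, admissible mu d l -> c <= cost nrm j l x) -> c <= cost_inf x.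
Proof.
move=> h; apply: lb_le_inf; first by exists (cost nrm j [::] x), [::].
by move=> _ [l hl <-]; exact: h.
Qed.

Lemma cost_inf_sublinear : group_sublinear cost_inf.
Proof.
have D x y : cost_inf (x + y) <= cost_inf x + cost_inf y.
  rewrite -lerBlDl; apply: le_cost_inf => l hl.
  suff : cost_inf (x + y) - cost nrm j l y <= cost_inf x by lra.
  apply: le_cost_inf => l' hl'.
  have := cost_inf_le (x + y) (admissible_cat hl' hl).
  by have := cost_cat (j := j) nrmS l' l x y; lra.
have P0 : cost_inf 0 = 0.
  apply/eqP; rewrite eq_le; apply/andP; split.
    have := @cost_inf_le [::] 0 I.
    by rewrite /= (group_sublinear0 nrmS) mulr0.
  by apply: le_cost_inf => l hl; exact: cost_ge0 hl.
split=> // x n; apply/eqP; rewrite eq_le subadditive_mulrn//=.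
case: n => [|n]; first by rewrite mulr0n P0 mul0r.
apply: le_cost_inf => l hl; rewrite cost_rescale//.
by apply: ler_wpM2l => //; apply: cost_inf_le; exact: admissible_rescale.
Qed.

End CostInf.

Lemma cost_isometry (R : realType) (W : lmodType rat) (U : zmodType)
    (mu : W -> R) (nrm : U -> R) (j : W -> U) l x :
  (forall x y, j (x + y) = j x + j y) -> (forall x, nrm (j x) = mu x) ->
  cost nrm j l (j x) = cost mu id l x.
Proof.
move=> jD jmu; have jB y z : j (y - z) = j y - j z.
  by apply: (addIr (j z)); rewrite -jD !subrK.
by elim: l x => [|[[c u] v] l IHl] x /=; rewrite ?jmu// -jB IHl.
Qed.

(** The hypothesis [0 < c] excludes the empty set, whose supremum is 0 by convention. *)
Lemma sup_ge_approx (R : realType) (A : set R) (c e : R) :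
  0 < c -> 0 < e -> c <= sup A -> exists2 a, A a & c - e < a.
Proof.
move=> c0 e0 cA; apply: contrapT => hA.
have [A0|/set0P A0] := eqVneq A set0; first by move: cA; rewrite A0 sup0; lra.
suff : sup A <= c - e by lra.
apply: ge_sup => // a Aa; rewrite leNgt; apply/negP => h.
by apply: hA; exists a.
Qed.

Lemma invn_le (R : realType) (e : R) :
  0 < e -> exists k : nat, k.+1%:R^-1 <= e :> R.
Proof.
move=> e0; exists (Num.truncn e^-1); rewrite invf_ple ?posrE//.
by rewrite ltW// truncnS_gt.
Qed.

Lemma le_invn (R : realType) (m n : nat) :
  (m <= n)%N -> n.+1%:R^-1 <= m.+1%:R^-1 :> R.
Proof. by move=> mn; rewrite lef_pV2 ?posrE// ler_nat. Qed.

Section NormedModule.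
Context {R : realType} {X : completeNormedModType R}.

Lemma dense_approx (T : Type) (j : T -> X) (x : X) (e : R) :
  dense (range j) -> 0 < e -> exists p, `|x - j p| < e.
Proof.
move=> dj e0; have [||_ [/[swap] [[p _ <-]] h]] := dj (ball x e).
- by exists x; exact: ballxx.
- exact: ball_open.
by exists p; move: h; rewrite -ball_normE.
Qed.

Lemma normed_group_sublinear : group_sublinear (fun x : X => `|x|).
Proof.
split; first exact: ler_normD.
by move=> x n; rewrite normrMn mulr_natl.
Qed.

(** Additivity gives rational homogeneity, and boundedness carries it over to real scalars by
    approximation. *)
Lemma bounded_additive_scalable (f : X -> R) (K : R) :
  (forall x y, f (x + y) = f x + f y) -> (forall x, f x <= K * `|x|) ->
  forall a x, f (a *: x) = a * f x.
Proof.
move=> fD fK a x.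
have f0 : f 0 = 0 by have := fD 0 0; rewrite addr0; lra.
have fN y : f (- y) = - f y by have := fD y (- y); rewrite subrr f0; lra.
have fratr c : f (ratr c *: x) = ratr c * f x.
  (* [additive_ratZ] concerns rational spaces, so it is applied along the line through [x],
     parametrised by [rat^o]. *)
  pose g (c : rat^o) : R := f (ratr c *: x).
  have gD c1 c2 : g (c1 + c2) = g c1 + g c2 by rewrite /g rmorphD /= scalerDl fD.
  have := @additive_ratZ _ _ g gD c 1.
  by rewrite /g rmorph1 scale1r /GRing.scale /= mulr1.
have K0 : 0 <= `|K| by [].
have fabs y : `|f y| <= `|K| * `|y|.
  have KK z : f z <= `|K| * `|z|.
    by apply: (le_trans (fK z)); apply: ler_wpM2r => //; exact: ler_norm.
  by rewrite ler_norml KK andbT lerNl -fN -(normrN y).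
apply/eqP; rewrite -subr_eq0 -normr_le0; apply/ler_addgt0Pr => e e0.
(* [B] bounds the total factor of the error [|a - ratr c|]; the summand 1 only makes it positive. *)
rewrite add0r; set B := 1 + `|K| * `|x| + `|f x|.
have KX0 : 0 <= `|K| * `|x| by rewrite mulr_ge0.
have B0 : 0 < B by rewrite /B -addrA ltr_pwDl// addr_ge0.
have eB : 0 < e / B by rewrite divr_gt0.
have [c] : exists c, ratr c \in `]a - e / B, a + e / B[.
  by apply: rat_in_itvoo; lra.
rewrite in_itv/= => /andP[c1 c2].
have ac : `|a - ratr c| <= e / B by rewrite ler_norml; lra.
have -> : f (a *: x) - a * f x = f ((a - ratr c) *: x) - (a - ratr c) * f x.
  by rewrite scalerBl fD fN fratr; ring.
apply: (le_trans (ler_normB _ _)); rewrite normrM.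
have h1 : `|f ((a - ratr c) *: x)| <= `|a - ratr c| * (`|K| * `|x|).
  by apply: (le_trans (fabs _)); rewrite normrZ mulrCA.
apply: (le_trans (lerD h1 (lexx _))); rewrite -mulrDr.
apply: (@le_trans _ _ (e / B * B)); last by rewrite divfK// gt_eqF.
by apply: ler_pM => //; rewrite ?addr_ge0// /B; lra.
Qed.

End NormedModule.

(** * Equivalence of the LDδP of the completion with the dual-free condition *)

Section LDPCharacterization.
Context {R : realType} {mu : V -> R} {X : completeNormedModType R} {j : V -> X}.
Hypothesis muX : is_Xmu mu j.
Implicit Types (delta : R) (x y : X) (p q : V).

Let jD p q : j (p + q) = j p + j q. Proof. by case: muX. Qed.
Let jmu p : `|j p| = mu p. Proof. by case: muX. Qed.
Let jdense : dense (range j). Proof. by case: muX. Qed.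

Let jB p q : j (p - q) = j p - j q.
Proof. by apply: (addIr (j q)); rewrite -jD !subrK. Qed.

Lemma dual_sphere_le (f : X -> R) x : in_dual_sphere f -> `|f x| <= `|x|.
Proof.
move=> [flin fsup].
have fZ a y : f (a *: y) = a * f y.
  by have := flin a y 0; rewrite (_ : f 0 = 0) ?addr0// -(subrr 0);
    have := flin (-1) 0 0; rewrite scaler0 addr0 subrr; lra.
have [->|x0] := eqVneq x 0; first by rewrite -(scale0r 0) fZ mul0r normr0.
have nx : 0 < `|x| by rewrite normr_gt0.
have [bnd|nb] := pselect (has_ubound [set `|f x| | x in @closed_unit_ball R X]).
  have : `|f (`|x|^-1 *: x)| <= 1.
    rewrite -fsup; apply: ub_le_sup => //; exists (`|x|^-1 *: x) => //.
    by rewrite /closed_unit_ball /= normfZV.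
  by rewrite fZ normrM normfV normr_id ler_pdivrMl// mulr1.
(* For an unbounded set [sup] takes the default value 0, which contradicts norm 1. *)
move: fsup; rewrite sup_out; last by move=> [].
by move=> /eqP; rewrite eq_sym oner_eq0.
Qed.

(** If a slice had diameter below [delta], no sufficiently separated pair could lie in it, so [f]
    would stay below [1 - b] at all admissible midpoints; the condition would then push the norm of
    [f] below 1. *)
Lemma LDP_of_condition delta :
  0 < delta -> LD_condition delta mu -> LDP delta X.
Proof.
move=> d0 cmu f fS alpha a0; have [flin fsup] := fS.
rewrite leNgt; apply/negP; set D := diam _ => Dd.
have fD x y : f (x + y) = f x + f y by have := flin 1 x y; rewrite scale1r mul1r.
have in_slice x y : slice f alpha x -> slice f alpha y -> `|x - y| <= D.
  move=> sx sy; apply: ub_le_sup; last by exists x => //; exists y.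
  exists 2 => _ [a [a1 _]] [b [b1 _]] <-.
  by apply: (le_trans (ler_normB _ _)); lra.
pose phi p := f (j p).
have phiD p q : phi (p + q) = phi p + phi q by rewrite /phi jD fD.
have phile p : phi p <= mu p.
  by rewrite -jmu; apply: le_trans (ler_norm _) _; exact: dual_sphere_le.
have mu0 p : 0 <= mu p by rewrite -jmu.
(* When [u] or [v] misses the slice, [phi u + phi v <= 2 - alpha <= 2 * (1 - b)]; the minimum with 1
   keeps [b <= 1 / 2]. *)
pose b := Num.min alpha 1 / 2.
have m0 : 0 < Num.min alpha 1 by rewrite lt_min a0 ltr01.
have m1 : Num.min alpha 1 <= 1 by rewrite ge_min lexx orbT.
have ma : Num.min alpha 1 <= alpha by rewrite ge_min lexx.
have [k0 k0D] := @invn_le R (delta - D) ltac:(lra).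
have phi_bound p : phi p <= (1 - b) * mu p.
  apply/ler_addgt0Pr => e e0; have [k1 k1e] := invn_le e0.
  have [l [hl ltl]] := cmu (maxn k0 k1) p.
  have kk0 := le_invn R (leq_maxl k0 k1).
  have kk1 := le_invn R (leq_maxr k0 k1).
  have : phi p <= (1 - b) * cost mu id l p.
    apply: (cost_functional_bound p phiD mu0 phile _ _ hl); first by rewrite /b; lra.
    move=> u v mu1 mv1 uv.
    have [fu|fu] := lerP (phi u) (1 - alpha).
      by have := phile v; rewrite /b; lra.
    have [fv|fv] := lerP (phi v) (1 - alpha).
      by have := phile u; rewrite /b; lra.
    have : `|j u - j v| <= D.
      by apply: in_slice; split=> //; rewrite jmu ltW.
    rewrite -jB jmu leNgt => /negP[]; apply: le_lt_trans uv.
    by rewrite lerBrDr -lerBrDl; exact: le_trans kk0 k0D.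
  have b0 : 0 <= 1 - b by rewrite /b; lra.
  have b1 : 1 - b <= 1 by rewrite /b; lra.
  move=> /le_trans; apply; apply: le_trans (ler_wpM2l b0 (ltW ltl)) _.
  rewrite mulrDr lerD2l; apply: le_trans (le_trans kk1 k1e).
  by rewrite ler_piMl// invr_ge0.
have f_bound x : `|f x| <= (1 - b) * `|x|.
  have f_le y : f y <= (1 - b) * `|y|.
    apply/ler_addgt0Pr => e e0.
    (* The error [e / 2] enters twice, through [f (y - j p)] and through the norm of [j p]. *)
    have [p yp] := dense_approx y jdense (e := e / 2) ltac:(lra).
    have h1 := dual_sphere_le (y - j p) fS.
    have h2 := ler_norm (f (y - j p)).
    have h3 : f y = f (y - j p) + phi p by rewrite /phi -fD subrK.
    have h4 := phi_bound p; rewrite -jmu in h4.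
    have h5 : `|j p| <= `|y| + `|y - j p|.
      by rewrite -{1}(subKr y (j p)); exact: ler_normB.
    have b1 : 0 < 1 - b <= 1 by rewrite /b; lra.
    by nra.
  rewrite ler_norml f_le andbT lerNl -[in leRHS]normrN.
  apply: le_trans (f_le _).
  have := fD x (- x); rewrite subrr.
  by have := fD 0 0; rewrite addr0; lra.
suff : sup [set `|f x| | x in @closed_unit_ball R X] <= 1 - b by rewrite fsup /b; lra.
apply: ge_sup; first by exists `|f 0|, 0 => //; rewrite /closed_unit_ball /= normr0.
move=> _ [x x1 <-]; apply: (le_trans (f_bound x)).
by rewrite /closed_unit_ball /= in x1; rewrite ler_piMr// /b; lra.
Qed.

(** If the condition fails at [p], then P exceeds the norm at [j p], and Hahn-Banach gives [f] below
    P of norm [N > 1]. A thin slice of [f / N] contains a widely separated pair, whose midpoint has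
    value near [N] under [f]; but [f] is at most 1 at admissible midpoints. *)
Lemma condition_of_LDP delta :
  0 < delta -> LDP delta X -> LD_condition delta mu.
Proof.
move=> d0 ldX k p; apply: contrapT => hno.
set k1 : R := k.+1%:R^-1 in hno *.
have k10 : 0 < k1 by rewrite /k1 invr_gt0.
pose P : X -> R := cost_inf mu (delta - k1) (fun x => `|x|) j.
have nS := @normed_group_sublinear R X.
have n0 (x : X) : 0 <= `|x| by [].
have PS : group_sublinear P := cost_inf_sublinear mu (delta - k1) nS n0 jD.
have Pp : mu p + k1 <= P (j p).
  apply: le_cost_inf => l hl; rewrite (cost_isometry _ _ jD jmu) leNgt.
  by apply/negP => h; apply: hno; exists l.
have [f [fD fP fp]] := hahn_banach (j p) PS.
have f2 x : f x <= 2 * `|x|.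
  apply: (le_trans (fP x)).
  exact: (@cost_inf_le _ _ _ mu (delta - k1) _ j n0 [::] x I).
have fZ := bounded_additive_scalable fD f2.
have f0 : f 0 = 0 by have := fD 0 0; rewrite addr0; lra.
have fN x : f (- x) = - f x by have := fD x (- x); rewrite subrr f0; lra.
have fabs x : `|f x| <= 2 * `|x| by rewrite ler_norml f2 andbT lerNl -fN -(normrN x).
have fuv u v : mu u < 1 -> mu v < 1 -> delta - k1 < mu (u - v) ->
    f (j u) + f (j v) <= 2.
  move=> mu1 mv1 uv.
  (* The list with the single entry [(1, u, v)] has cost 1 at the midpoint, since nothing remains
     after subtraction. *)
  have := fP (j ((1 / 2 : rat) *: (u + v))).
  have adm : admissible mu (delta - k1) [:: (1, u, v)] by [].
  have := cost_inf_le j n0 (j ((1 / 2 : rat) *: (u + v))) adm.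
  rewrite /= subrr normr0 rmorph1 -/P.
  have -> : f (j ((1 / 2 : rat) *: (u + v))) = (f (j u) + f (j v)) / 2.
    have -> : f (j u) + f (j v) = f (j (u + v)) by rewrite jD fD.
    have jr : f (j (u + v)) = f (j ((1 / 2 : rat) *: (u + v)))
         + f (j ((1 / 2 : rat) *: (u + v))).
      by rewrite -fD -jD -scalerDl -mulrDl divff// scale1r.
    by rewrite jr; lra.
  lra.
pose A := [set `|f x| | x in @closed_unit_ball R X].
have A0 : A !=set0.
  by exists `|f 0|, 0 => //; rewrite /closed_unit_ball /= normr0.
have Aub : has_ubound A.
  exists 2 => _ [x x1 <-]; apply: (le_trans (fabs x)).
  by rewrite /closed_unit_ball /= in x1; lra.
pose N := sup A.
have fN_le x : `|f x| <= N * `|x|.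
  have [->|x0] := eqVneq x 0; first by rewrite f0 !normr0 mulr0.
  have nx : 0 < `|x| by rewrite normr_gt0.
  have : `|f (`|x|^-1 *: x)| <= N.
    apply: ub_le_sup => //; exists (`|x|^-1 *: x) => //.
    by rewrite /closed_unit_ball /= normfZV.
  by rewrite fZ normrM normfV normr_id ler_pdivrMl// mulrC.
have N1 : 1 < N.
  rewrite ltNge; apply/negP => N1.
  have h1 := fN_le (j p); have h2 := ler_norm (f (j p)).
  have h3 : N * `|j p| <= `|j p| by rewrite ler_piMl.
  by have := jmu p; lra.
have N0 : 0 < N by lra.
have NV : N * N^-1 = 1 by rewrite divff// gt_eqF.
pose g x := f x / N.
have gS : in_dual_sphere g.
  split; first by move=> a x y; rewrite /g fD fZ mulrDl mulrA.
  set B := [set _ | _ in _].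
  have B0 : B !=set0 by exists `|g 0|, 0 => //; rewrite /closed_unit_ball /= normr0.
  have gle x : `|g x| <= `|x|.
    rewrite /g normrM normfV (gtr0_norm N0) ler_pdivrMr// mulrC; exact: fN_le.
  have Bub : has_ubound B.
    exists 1 => _ [x x1 <-]; exact: le_trans (gle x) x1.
  apply/eqP; rewrite eq_le; apply/andP; split.
    apply: ge_sup => // _ [x x1 <-]; exact: le_trans (gle x) x1.
  suff : N <= N * sup B by rewrite ler_pMr.
  apply: ge_sup => // _ [x x1 <-].
  rewrite mulrC -ler_pdivrMr//.
  have -> : `|f x| / N = `|g x| by rewrite /g normrM normfV (gtr0_norm N0).
  by apply: ub_le_sup => //; exists x.
(* The first bound gives [N * (1 - 3 * t) >= 1] for the final contradiction; the second lets two
   approximations, each of error [2 * t], cost at most [k1 / 2] in distance. *)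
pose t := Num.min ((1 - N^-1) / 3) (k1 / 8).
have NV1 : N^-1 < 1 by rewrite invf_lt1.
have t0 : 0 < t by rewrite lt_min; apply/andP; split; lra.
have t1 : t <= (1 - N^-1) / 3 by rewrite ge_min lexx.
have t2 : t <= k1 / 8 by rewrite ge_min lexx orbT.
have NV0 : 0 < N^-1 by rewrite invr_gt0.
have tlt1 : t < 1 by lra.
have [_ [a [a1 ga] [b [b1 gb] <-]] hab] :=
  sup_ge_approx d0 (e := k1 / 2) ltac:(lra) (ldX g gS t t0).
have gle x : `|g x| <= `|x| := dual_sphere_le x gS.
have gD x y : g (x + y) = g x + g y by rewrite /g fD mulrDl.
have approx_ball c : `|c| <= 1 ->
    exists u, [/\ mu u < 1, `|c - j u| <= 2 * t & g c - 2 * t <= g (j u)].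
  (* Shrinking by [1 - t] first leaves room for an approximation error below [t] inside the open
     unit ball. *)
  move=> c1; have [u cu] := dense_approx ((1 - t) *: c) jdense t0.
  have tc : `|t *: c| <= t by rewrite normrZ gtr0_norm// ler_piMr// ltW.
  have cju : `|c - j u| <= 2 * t.
    have -> : c - j u = ((1 - t) *: c - j u) + t *: c.
      by rewrite addrAC -scalerDl subrK scale1r.
    by apply: (le_trans (ler_normD _ _)); lra.
  exists u; split => //.
    rewrite -jmu -(subKr ((1 - t) *: c) (j u)).
    apply: (le_lt_trans (ler_normB _ _)).
    have : `|(1 - t) *: c| <= 1 - t.
      by rewrite normrZ gtr0_norm; [rewrite ler_piMr//; lra|lra].
    by lra.
  have := gD (c - j u) (j u); rewrite subrK.
  by have := gle (c - j u); have := ler_norm (g (c - j u)); lra.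
have [u [mu1 au gu]] := approx_ball a a1.
have [v [mv1 bv gv]] := approx_ball b b1.
have uv : delta - k1 < mu (u - v).
  rewrite -jmu jB.
  have : `|a - b| <= `|j u - j v| + `|a - j u| + `|b - j v|.
    have -> : a - b = (j u - j v) + (a - j u) - (b - j v).
      rewrite opprB [j u - j v + _]addrC (addrA (a - j u)) subrK.
      by rewrite (addrA (a - j v)) subrK.
    apply: (le_trans (ler_normB _ _)); rewrite lerD2r; exact: ler_normD.
  by lra.
have := fuv u v mu1 mv1 uv.
have fg x : f x = N * g x by rewrite /g mulrCA NV mulr1.
rewrite !fg => hle.
have : N * (1 - 3 * t) < 1.
  have : N * (2 * (1 - 3 * t)) < N * (g (j u) + g (j v)) by rewrite ltr_pM2l//; lra.
  by lra.
have : N * (3 * t) <= N * (1 - N^-1) by rewrite ler_pM2l//; lra.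
by rewrite mulrBr NV; lra.
Qed.

End LDPCharacterization.

Theorem Xmu_LDP_condition (R : realType) (mu : V -> R) (delta : R) :
  0 < delta -> Pset mu -> Xmu_LDP delta mu <-> LD_condition delta mu.
Proof.
move=> d0 muS; split=> [h|c X j muX]; last exact: LDP_of_condition muX _ d0 c.
have [X [j muX]] := completion_exists muS.
exact: condition_of_LDP muX _ d0 (h X j muX).
Qed.

(** * Openness of the conditions *)

Section GdeltaCondition.
Context {R : realType}.
Implicit Types (d : R) (l : seq (rat * V * V)).

Lemma continuous_evaluation (p : V) : continuous (fun mu : RV R => mu p).
Proof. exact: (@proj_continuous V (fun=> R) p). Qed.

Lemma continuous_realD (T : topologicalType) (f g : T -> R) :
  continuous f -> continuous g -> continuous (fun x => f x + g x).
Proof. by move=> cf cg x; apply: cvgD; [exact: cf|exact: cg]. Qed.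

Lemma continuous_realM (T : topologicalType) (f g : T -> R) :
  continuous f -> continuous g -> continuous (fun x => f x * g x).
Proof. by move=> cf cg x; apply: cvgM; [exact: cf|exact: cg]. Qed.

Lemma continuous_cost l (p : V) :
  continuous (fun mu : RV R => cost mu id l p).
Proof.
elim: l p => [|[[c u] v] l IHl] p.
  apply: (@continuous_realM _ (fun=> 2) (fun mu : RV R => mu p)).
    exact: cst_continuous.
  exact: continuous_evaluation.
apply: (@continuous_realD _ (fun=> ratr c)
  (fun mu : RV R => cost mu id l (p - (c / 2) *: (u + v)))).
  exact: cst_continuous.
exact: IHl.
Qed.

Lemma open_lt_continuous (T : topologicalType) (f g : T -> R) :
  continuous f -> continuous g -> open [set x | f x < g x].
Proof.
move=> cf cg; rewrite (_ : [set _ | _] = (fun x => g x - f x) @^-1` [set r | 0 < r]).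
  apply: open_comp; last exact: open_gt.
  by move=> x _; apply: cvgB; [exact: cg|exact: cf].
by apply/seteqP; split=> x /=; rewrite subr_gt0.
Qed.

Lemma open_admissible d l : open [set mu : RV R | admissible mu d l].
Proof.
elim: l => [|[[c u] v] l IHl] /=; first exact: openT.
have [c0|c0] := pselect (0 <= c); last first.
  by rewrite (_ : [set _ | _] = set0); [exact: open0|apply/seteqP; split=> mu //= [[]]].
rewrite (_ : [set _ | _] = [set mu : RV R | mu u < 1] `&` [set mu : RV R | mu v < 1]
  `&` [set mu : RV R | d < mu (u - v)] `&` [set mu : RV R | admissible mu d l]).
  by apply: openI => //; apply: openI; [apply: openI|]; apply: open_lt_continuous;
    try exact: continuous_evaluation; exact: cst_continuous.
by apply/seteqP; split=> mu /=; [move=> [[]]|move=> [[[]]]].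
Qed.

(** For fixed [k] and [p] the existential over [l] is a union of open sets, and countability of [V]
    leaves only countably many pairs. *)
Lemma Gdelta_LD_condition (J : set (RV R)) (delta : R) :
  Gdelta ([set mu : subspace J | J mu /\ LD_condition delta (mu : V -> R)]).
Proof.
pose G (kp : nat * V) : set (RV R) := [set mu | exists l,
  admissible mu (delta - kp.1.+1%:R^-1) l /\
  cost mu id l kp.2 < mu kp.2 + kp.1.+1%:R^-1].
have oG kp : open (G kp).
  rewrite (_ : G kp = \bigcup_l ([set mu : RV R | admissible mu (delta - kp.1.+1%:R^-1) l]
    `&` [set mu : RV R | cost mu id l kp.2 < mu kp.2 + kp.1.+1%:R^-1])).
    apply: bigcup_open => l _; apply: openI; first exact: open_admissible.
    apply: open_lt_continuous; first exact: continuous_cost.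
    apply: (@continuous_realD _ (fun mu : RV R => mu kp.2) (fun=> kp.1.+1%:R^-1)).
      exact: continuous_evaluation.
    exact: cst_continuous.
  by apply/seteqP; split=> mu; [move=> [l hl]; exists l|move=> [l _ hl]; exists l].
(* The pair [(k, p)] is decoded from [n]; a number that codes no pair imposes no condition beyond
   [J]. *)
exists (fun n => J `&` (if unpickle n is Some kp then G kp else setT : set (RV R))).
  move=> n; rewrite open_subspaceTI; apply: open_subspaceW.
  by case: (unpickle n) => [kp|]; [exact: oG|exact: openT].
apply/seteqP; split=> mu.
  by move=> [Jmu h] n _; split => //; case: (unpickle n) => // -[k p]; exact: h.
move=> h; split; first by have [] := h 0%N I.
by move=> k p; have [_] := h (pickle (k, p)) I; rewrite pickleK.
Qed.

End GdeltaCondition.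

(** * A family of block norms *)

Section BlockNorm.
Context {R : realType}.
Implicit Types (a b : nat -> R) (t : nat -> R) (i k m n : nat).

Fixpoint running_max a m : R :=
  if m is k.+1 then Num.max (running_max a k) (a k) else 0.

Lemma running_max_ge0 a m : 0 <= running_max a m.
Proof. by elim: m => //= m IHm; rewrite le_max IHm. Qed.

Lemma le_running_max a m i : (i < m)%N -> a i <= running_max a m.
Proof.
elim: m => //= m IHm; rewrite ltnS leq_eqVlt => /predU1P[->|/IHm h].
  by rewrite le_max lexx orbT.
by rewrite le_max h.
Qed.

Lemma running_max_le a m c :
  0 <= c -> (forall i, (i < m)%N -> a i <= c) -> running_max a m <= c.
Proof.
move=> c0; elim: m => //= m IHm h; rewrite ge_max h ?leqnn// andbT.
by apply: IHm => i im; apply: h; rewrite ltnS ltnW.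
Qed.

Lemma eq_running_max a b m :
  (forall i, (i < m)%N -> a i = b i) -> running_max a m = running_max b m.
Proof.
elim: m => //= m IHm h; rewrite h// IHm// => i im.
by apply: h; rewrite ltnS ltnW.
Qed.

Lemma running_maxZ a c m : 0 <= c ->
  running_max (fun i => c * a i) m = c * running_max a m.
Proof.
by move=> c0; elim: m => [|m IHm] /=; rewrite ?mulr0// maxr_pMr// IHm.
Qed.

(* The classes [logn 2 i.+1 = n] partition the indices [i] into infinitely many
   infinite blocks. *)
Definition block i := logn 2 i.+1.

(** Coordinates below [m] therefore meet only blocks below [m], which lets [total_norm] truncate
    coordinates and blocks at the same [m]. *)
Lemma block_le i : (block i <= i)%N.
Proof. by rewrite -ltnS; apply: ltn_logl. Qed.

Lemma block_unbounded n m : exists2 k, (m <= k)%N & block k = n.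
Proof.
(* The cofactor is odd, so the 2-adic valuation is [n]; the predecessor undoes the shift in
   [block]. *)
exists (2 ^ n * m.*2.+1).-1.
  rewrite -ltnS prednK ?muln_gt0 ?expn_gt0//.
  apply: (@leq_trans m.*2.+1); first by rewrite ltnS -addnn leq_addr.
  by rewrite leq_pmull// expn_gt0.
rewrite /block prednK ?muln_gt0 ?expn_gt0// lognM ?expn_gt0// pfactorK//.
by rewrite lognE /= dvdn2 /= odd_double addn0.
Qed.

Definition weight i : R := 2^-1 ^+ i.

Lemma weight_gt0 i : 0 < weight i.
Proof. by rewrite exprn_gt0// invr_gt0. Qed.

Definition on_block n a i : R := if block i == n then `|a i| else 0.

Lemma on_block_ge0 n a i : 0 <= on_block n a i.
Proof. by rewrite /on_block; case: ifP. Qed.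

Definition block_norm t m n a : R :=
  Num.max (\sum_(i < m) weight i * on_block n a i)
          (t n * running_max (on_block n a) m).

Definition total_norm t m a : R := \sum_(n < m) block_norm t m n a.

Lemma block_norm_ge0 t m n a : 0 <= block_norm t m n a.
Proof.
rewrite le_max sumr_ge0// => i _.
by rewrite mulr_ge0 ?on_block_ge0// ltW// weight_gt0.
Qed.

Lemma block_norm0 t m n a :
  (forall i, (i < m)%N -> on_block n a i = 0) -> block_norm t m n a = 0.
Proof.
move=> h; rewrite /block_norm big1 => [|i _]; last by rewrite h ?mulr0.
suff -> : running_max (on_block n a) m = 0 by rewrite mulr0 maxxx.
apply/eqP; rewrite eq_le running_max_ge0 andbT.
by apply: running_max_le => // i /h ->.
Qed.

Lemma eq_block_norm t m n a b :
  (forall i, (i < m)%N -> on_block n a i = on_block n b i) ->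
  block_norm t m n a = block_norm t m n b.
Proof.
move=> h; rewrite /block_norm; congr Num.max.
  by apply: eq_bigr => i _; rewrite h.
by congr (_ * _); exact: eq_running_max.
Qed.

Lemma block_normS t m n a :
  on_block n a m = 0 -> block_norm t m.+1 n a = block_norm t m n a.
Proof.
move=> am; rewrite /block_norm big_ord_recr /= am mulr0 addr0.
by rewrite [Num.max _ 0]max_l// running_max_ge0.
Qed.

Lemma total_normS t m a : a m = 0 -> total_norm t m.+1 a = total_norm t m a.
Proof.
move=> am; have am' n : on_block n a m = 0.
  by rewrite /on_block am normr0; case: ifP.
rewrite /total_norm big_ord_recr /= block_normS// (_ : block_norm t m m a = 0).
  by rewrite addr0; apply: eq_bigr => n _; rewrite block_normS.
apply: block_norm0 => i im; rewrite /on_block ifF//.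
by apply/negbTE; rewrite neq_ltn (leq_ltn_trans (block_le i) im).
Qed.

Lemma total_norm_widen t m k a : (m <= k)%N ->
  (forall i, (m <= i)%N -> a i = 0) -> total_norm t k a = total_norm t m a.
Proof.
move=> mk a0; rewrite -(subnKC mk); elim: (k - m)%N => [|d IHd].
  by rewrite addn0.
by rewrite addnS total_normS// a0// leq_addr.
Qed.

Lemma block_norm_le t m n a : (n < m)%N -> block_norm t m n a <= total_norm t m a.
Proof.
move=> nm; rewrite /total_norm (bigD1 (Ordinal nm))//= lerDl.
by apply: sumr_ge0 => k _; exact: block_norm_ge0.
Qed.

(** A bound independent of [t]: coordinates remain controlled when parameters vanish. Infinite
    dimension and membership in [Bset] rest on it. *)
Lemma weight_le_total_norm t m a i : (i < m)%N ->
  weight i * `|a i| <= total_norm t m a.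
Proof.
move=> im; apply: le_trans (block_norm_le t a (leq_ltn_trans (block_le i) im)).
rewrite le_max (bigD1 (Ordinal im))//= {1}/on_block eqxx lerDl sumr_ge0// => k _.
by rewrite mulr_ge0 ?on_block_ge0// ltW// weight_gt0.
Qed.

Lemma param_le_total_norm t m a i : 0 <= t (block i) -> (i < m)%N ->
  t (block i) * `|a i| <= total_norm t m a.
Proof.
move=> t0 im; apply: le_trans (block_norm_le t a (leq_ltn_trans (block_le i) im)).
rewrite le_max; apply/orP; right; apply: ler_wpM2l => //.
have -> : `|a i| = on_block (block i) a i by rewrite /on_block eqxx.
exact: le_running_max.
Qed.

Lemma total_normD t m a b : (forall n, 0 <= t n) ->
  total_norm t m (fun i => a i + b i) <= total_norm t m a + total_norm t m b.
Proof.
move=> t0; rewrite /total_norm -big_split/=; apply: ler_sum => n _.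
have D i : on_block n (fun i => a i + b i) i <= on_block n a i + on_block n b i.
  by rewrite /on_block; case: ifP => _; [exact: ler_normD|rewrite addr0].
rewrite {1}/block_norm ge_max; apply/andP; split.
  apply: (@le_trans _ _ (\sum_(i < m) weight i * on_block n a i +
                         \sum_(i < m) weight i * on_block n b i)).
    rewrite -big_split/=; apply: ler_sum => i _.
    by rewrite -mulrDr ler_wpM2l// ltW// weight_gt0.
  by apply: lerD; rewrite le_max lexx.
apply: (@le_trans _ _ (t n * running_max (on_block n a) m +
                       t n * running_max (on_block n b) m)).
  rewrite -mulrDr; apply: ler_wpM2l => //; apply: running_max_le.
    by rewrite addr_ge0// running_max_ge0.
  move=> i im; apply: (le_trans (D i)).
  by apply: lerD; exact: le_running_max.
by apply: lerD; rewrite le_max lexx orbT.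
Qed.

Lemma total_normZ t m c a :
  total_norm t m (fun i => c * a i) = `|c| * total_norm t m a.
Proof.
rewrite /total_norm mulr_sumr; apply: eq_bigr => n _.
have Z i : on_block n (fun i => c * a i) i = `|c| * on_block n a i.
  by rewrite /on_block normrM; case: ifP => _ //; rewrite mulr0.
rewrite /block_norm maxr_pMr//; congr Num.max.
  by rewrite mulr_sumr; apply: eq_bigr => i _; rewrite Z mulrCA.
rewrite mulrCA -(running_maxZ _ _ (normr_ge0 c)); congr (_ * _).
by apply: eq_running_max => i _; rewrite Z.
Qed.

Lemma total_norm_block t m n a : (n < m)%N ->
  (forall i, block i != n -> a i = 0) -> total_norm t m a = block_norm t m n a.
Proof.
move=> nm a0; rewrite /total_norm (bigD1 (Ordinal nm))//= big1 ?addr0// => k kn.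
apply: block_norm0 => i _; rewrite /on_block; case: ifP => // /eqP ik.
by rewrite a0 ?normr0// ik.
Qed.

(* With a vanishing parameter the block carries a weighted l1 norm, so that
   every coordinate of the block splits off. *)
Lemma total_norm_split t m a i : t (block i) = 0 -> (i < m)%N ->
  total_norm t m a =
  weight i * `|a i| + total_norm t m (fun k => if k == i then 0 else a k).
Proof.
move=> ti im; have bm := leq_ltn_trans (block_le i) im.
rewrite /total_norm (bigD1 (Ordinal bm))//= [in RHS](bigD1 (Ordinal bm))//= addrA.
congr (_ + _); last first.
  apply: eq_bigr => n ni; apply: eq_block_norm => k _; rewrite /on_block.
  case: eqP => // kn; case: eqP => // ki; move: ni.
  by rewrite -val_eqE/= -kn ki eqxx.
have pos b : 0 <= \sum_(k < m) weight k * on_block (block i) b k.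
  by apply: sumr_ge0 => k _; rewrite mulr_ge0 ?on_block_ge0// ltW// weight_gt0.
rewrite /block_norm ti !mul0r !max_l// (bigD1 (Ordinal im))//=.
rewrite [in RHS](bigD1 (Ordinal im))//= {1 3}/on_block !eqxx normr0 mulr0 add0r.
congr (_ + _); apply: eq_bigr => k ki.
have /negbTE kif : (k : nat) != i by move: ki; rewrite -val_eqE.
by rewrite /on_block kif.
Qed.

(** A coordinate beyond the support adds only its small weight to the l1 part, and enters the sup
    part through a maximum instead of a sum. *)
Lemma total_norm_add_far t m a b c :
  (forall n, 0 <= t n) -> (block m < m.+1)%N ->
  (forall i, (m <= i)%N -> a i = 0) -> (forall i, block i != block m -> a i = 0) ->
  (forall i, b i = if i == m then c else a i) ->
  total_norm t m.+1 b <=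
  Num.max (total_norm t m.+1 a + weight m * `|c|)
          (Num.max (total_norm t m.+1 a) (t (block m) * `|c|)).
Proof.
move=> t0 nm am an bE; set n := block m in nm an *.
have bi i : (i < m)%N -> on_block n b i = on_block n a i.
  by move=> im; rewrite /on_block bE (ltn_eqF im).
have bn i : block i != n -> b i = 0.
  by move=> h; rewrite bE; case: eqP => [im|_]; [move: h; rewrite im eqxx|exact: an].
rewrite (total_norm_block t nm bn) (total_norm_block t nm an).
have bm : on_block n b m = `|c| by rewrite /on_block bE !eqxx.
have a0 : on_block n a m = 0 by rewrite /on_block am ?normr0 ?if_same.
rewrite {1}/block_norm big_ord_recr/= bm block_normS//.
have <- : \sum_(i < m) weight i * on_block n a i =
          \sum_(i < m) weight i * on_block n b i.
  by apply: eq_bigr => i _; rewrite bi.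
rewrite (eq_running_max bi) /block_norm ge_max; apply/andP; split.
  by rewrite le_max lerD2r le_max lexx.
by rewrite maxr_pMr// !ge_max !le_max !lexx !orbT.
Qed.

End BlockNorm.

(** * Block seminorms on [V], and when they satisfy the LD condition *)

Section BlockSeminorm.
Context {R : realType}.
Variable t : nat -> R.
Hypothesis t0 : forall n, 0 <= t n.
Implicit Types (p q : V) (i k m n : nat).

Definition rat_coef (p : V) : nat -> R := fun i => ratr p`_i.

Definition block_seminorm (s : nat -> R) (p : V) : R :=
  total_norm s (size p) (rat_coef p).

Lemma block_seminormE (s : nat -> R) m p : (size p <= m)%N ->
  block_seminorm s p = total_norm s m (rat_coef p).
Proof.
move=> pm; apply/esym/total_norm_widen => // i pi.
by rewrite /rat_coef nth_default// rmorph0.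
Qed.

Lemma rat_coefD p q : rat_coef (p + q) = fun i => rat_coef p i + rat_coef q i.
Proof. by apply/funext => i; rewrite /rat_coef coefD rmorphD. Qed.

Lemma rat_coefZ c p : rat_coef (c *: p) = fun i => ratr c * rat_coef p i.
Proof. by apply/funext => i; rewrite /rat_coef coefZ rmorphM. Qed.

Lemma block_seminorm_Pset : Pset (block_seminorm t : RV R).
Proof.
split=> [p q|c p].
  have pm := leq_maxl (size p) (size q); have qm := leq_maxr (size p) (size q).
  rewrite (block_seminormE t (size_polyD p q)) (block_seminormE t pm).
  by rewrite (block_seminormE t qm) rat_coefD total_normD.
by rewrite (block_seminormE t (size_scale_leq c p)) rat_coefZ total_normZ.
Qed.

Let muS : rat_seminorm (block_seminorm t) := block_seminorm_Pset.

Lemma weight_le_block_seminorm p i :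
  weight i * `|rat_coef p i| <= block_seminorm t p.
Proof.
rewrite (block_seminormE t (leq_maxl (size p) i.+1)).
by apply: weight_le_total_norm; exact: leq_maxr.
Qed.

Lemma param_le_block_seminorm p i :
  t (block i) * `|rat_coef p i| <= block_seminorm t p.
Proof.
rewrite (block_seminormE t (leq_maxl (size p) i.+1)).
by apply: param_le_total_norm => //; exact: leq_maxr.
Qed.

Definition block_part n p : V :=
  \poly_(i < size p) (if block i == n then p`_i else 0).

Lemma coef_block_part n p i :
  (block_part n p)`_i = if block i == n then p`_i else 0.
Proof.
by rewrite coef_poly; case: ltnP => // h; rewrite nth_default// if_same.
Qed.

Lemma sum_block_part p : p = \sum_(n < size p) block_part n p.
Proof.
apply/polyP => i; rewrite coef_sum.
under eq_bigr do rewrite coef_block_part.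
have [ip|pi] := ltnP i (size p); last first.
  by rewrite nth_default// big1// => n _; rewrite if_same.
rewrite (bigD1 (Ordinal (leq_ltn_trans (block_le i) ip)))//= eqxx big1 ?addr0//.
by move=> n; rewrite -val_eqE/= eq_sym => /negbTE ->.
Qed.

Lemma block_seminorm_sum p :
  block_seminorm t p = \sum_(n < size p) block_seminorm t (block_part n p).
Proof.
rewrite {1}/block_seminorm; apply: eq_bigr => n _.
rewrite (block_seminormE t (size_poly (size p) _)).
rewrite (@total_norm_block _ t (size p) n)//.
  apply: eq_block_norm => i _; rewrite /on_block /rat_coef coef_block_part.
  by case: ifP.
by move=> i /negbTE h; rewrite /rat_coef coef_block_part h rmorph0.
Qed.

Lemma weight_small (e c : R) m n : 0 < e -> 0 <= c ->
  exists k, [/\ (m <= k)%N, (block k < k.+1)%N, block k = n & weight k * c < e].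
Proof.
move=> e0 c0.
have [k0 hk0] : exists k0, forall k, (k0 <= k)%N -> weight k * c < e.
  have [k1 hk1] := @invn_le R (e / (1 + c)) ltac:(by rewrite divr_gt0// ltr_pwDl).
  exists k1.+1 => k kk.
  have wk : weight k < k1.+1%:R^-1 :> R.
    rewrite /weight exprVn ltf_pV2 ?posrE// ?exprn_gt0// -natrX ltr_nat.
    by apply: leq_ltn_trans kk _; exact: ltn_expl.
  have := lt_le_trans wk hk1; rewrite ltr_pdivlMr ?ltr_pwDl//.
  apply: le_lt_trans; apply: ler_wpM2l; first by rewrite ltW// weight_gt0.
  by rewrite lerDr.
have [k kk bk] := block_unbounded n (maxn m k0).
exists k; split => //; first exact: leq_trans (leq_maxl _ _) kk.
  by rewrite ltnS block_le.
by apply: hk0; exact: leq_trans (leq_maxr _ _) kk.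
Qed.

(* Inside a block with positive parameter the norm is locally almost square:
   adding a far unit vector of the right size changes the norm only slightly. *)
Lemma cost_inf_block (d : R) n p :
  d < 2 -> 0 < t n -> (forall i, block i != n -> p`_i = 0) ->
  cost_inf (block_seminorm t) d (block_seminorm t) id p <= block_seminorm t p.
Proof.
move=> d2 tn pn; set mu := block_seminorm t.
have mu0 q : 0 <= mu q := rat_seminorm_ge0 muS q.
apply/ler_addgt0Pr => e e0.
(* Coefficients of lists are rational, so [mu p] is replaced by a rational [s] slightly above it, to
   become the cost. *)
have [s] : exists s, ratr s \in `]mu p, mu p + e[ by apply: rat_in_itvoo; lra.
rewrite in_itv/= => /andP[s1 s2].
have s0 : 0 < ratr s :> R by exact: le_lt_trans (mu0 p) s1.
pose d' := Num.max 0 (d / 2).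
have d'1 : d' < 1 by rewrite /d' gt_max; apply/andP; split; lra.
have d'0 : 0 <= d' by rewrite le_max lexx.
have d'd : d / 2 <= d' by rewrite le_max lexx orbT.
(* The upper bound gives [t n * c < s], which keeps the norms of [p + z] and [p - z] below [s]; the
   lower bound makes the norm of [2 z] exceed [d * s]. The maximum with 0 in [d'] keeps [c]
   positive. *)
have [c] : exists c, ratr c \in `]ratr s * d' / t n, ratr s / t n[.
  by apply: rat_in_itvoo; rewrite ltr_pM2r ?invr_gt0// gtr_pMr.
rewrite in_itv/= ltr_pdivrMr// ltr_pdivlMr// => /andP[c1 c2].
have c0 : 0 < ratr c :> R.
  by rewrite -(pmulr_lgt0 _ tn); apply: le_lt_trans c1; rewrite mulr_ge0// ltW.
have sp : 0 < ratr s - mu p by lra.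
have [k [kp bk kn wk]] := weight_small (size p) n sp (ltW c0).
pose z : V := c *: 'X^k.
have coefz i : rat_coef z i = if i == k then ratr c else 0.
  by rewrite /rat_coef coefZ coefXn; case: eqP; rewrite ?mulr1 ?mulr0 ?rmorph0.
have pk i : (k <= i)%N -> rat_coef p i = 0.
  by move=> ki; rewrite /rat_coef nth_default ?rmorph0//; exact: leq_trans ki.
have far q r : (size q <= k.+1)%N -> `|r| = ratr c ->
    (forall i, rat_coef q i = if i == k then r else rat_coef p i) -> mu q < ratr s.
  move=> qk rc qE; rewrite /mu (block_seminormE t qk).
  apply: le_lt_trans (total_norm_add_far t0 bk pk _ qE) _.
    by move=> i; rewrite kn => h; rewrite /rat_coef pn// rmorph0.
  rewrite -(block_seminormE t (leqW kp)) -/mu kn rc !gt_max s1 /=.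
  by apply/andP; split; [lra|rewrite mulrC].
have zk : (size z <= k.+1)%N.
  by apply: leq_trans (size_scale_leq _ _) _; rewrite size_polyXn.
have mu1 : mu (p + z) < ratr s.
  apply: (far _ (ratr c)); last 1 first.
  - move=> i; rewrite rat_coefD coefz; case: eqP => [->|_]; last by rewrite addr0.
    by rewrite pk// add0r.
  - by apply: leq_trans (size_polyD _ _) _; rewrite geq_max zk leqW.
  - by rewrite gtr0_norm.
have mu2 : mu (p - z) < ratr s.
  apply: (far _ (- ratr c)); last 1 first.
  - move=> i; rewrite rat_coefD -scaleN1r rat_coefZ coefz rmorphN1 mulN1r.
    case: eqP => [->|_]; last by rewrite oppr0 addr0.
    by rewrite pk// add0r.
  - by apply: leq_trans (size_polyD _ _) _; rewrite geq_max size_polyN zk leqW.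
  - by rewrite normrN gtr0_norm.
have sz : s != 0 by apply/eqP => h; move: s0; rewrite h rmorph0 ltxx.
have muZ q : mu (s^-1 *: q) = mu q / ratr s.
  by rewrite /mu muS.2 fmorphV normfV gtr0_norm// mulrC.
(* [s] times the midpoint of this pair is exactly [p], so the total cost is [s]. *)
pose l : seq (rat * V * V) := [:: (s, s^-1 *: (p + z), s^-1 *: (p - z))].
have adm : admissible mu d l.
  split=> //; split.
  - by rewrite -(ler0q R) ltW.
  - by rewrite muZ ltr_pdivrMr// mul1r.
  - by rewrite muZ ltr_pdivrMr// mul1r.
  rewrite -scalerBr muZ opprB addrC addrA subrK.
  rewrite ltr_pdivlMr//.
  have := param_le_block_seminorm (z + z) k.
  rewrite rat_coefD coefz eqxx kn ger0_norm ?addr_ge0 ?(ltW c0)// -/mu.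
  apply: lt_le_trans.
  have : d / 2 * ratr s <= d' * ratr s by rewrite ler_pM2r.
  by lra.
apply: (le_trans (cost_inf_le id mu0 p adm)); rewrite /=.
have -> : p - (s / 2) *: (s^-1 *: (p + z) + s^-1 *: (p - z)) = 0.
  rewrite -scalerDr scalerA addrACA subrr addr0 mulrAC divff// mul1r.
  by rewrite scalerDr -scalerDl (_ : 2^-1 + 2^-1 = 1 :> rat)// scale1r subrr.
by rewrite /mu (rat_seminorm0 muS) mulr0 addr0 ltW.
Qed.

Lemma LD_condition_block_seminorm (delta : R) :
  delta <= 2 -> (forall n, 0 < t n) -> LD_condition delta (block_seminorm t).
Proof.
move=> d2 tpos k p; set mu := block_seminorm t.
set e : R := k.+1%:R^-1; have e0 : 0 < e by rewrite invr_gt0.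
have mu0 q : 0 <= mu q := rat_seminorm_ge0 muS q.
have PS := @cost_inf_sublinear _ _ _ mu (delta - e) mu id
  (rat_seminorm_group_sublinear muS) mu0 (fun _ _ => erefl).
have Pp : cost_inf mu (delta - e) mu id p <= mu p.
  rewrite {1}(sum_block_part p) /mu (block_seminorm_sum p) -/mu.
  elim/big_ind2 : _ => [|x1 y1 x2 y2 h1 h2|n _].
  - by rewrite (group_sublinear0 PS).
  - by apply: le_trans (PS.1 _ _) _; exact: lerD.
  (* The loss [e] brings the separation strictly below 2, even for [delta = 2]. *)
  apply: (cost_inf_block _ (tpos n)); first by lra.
  by move=> i /negbTE h; rewrite coef_block_part h.
have hi : has_inf [set cost mu id l p | l in admissible mu (delta - e)].
  split; first by exists (cost mu id [::] p), [::].
  by exists 0 => _ [l hl <-]; exact: cost_ge0 hl.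
have [_ [l hl <-] hlt] := inf_adherent e0 hi.
by exists l; split => //; apply: lt_le_trans hlt _; rewrite lerD2r.
Qed.

(** The scaled coordinate [phi] splits off as an l1-summand: where it is nearly 1 the remaining part
    is small, so two such points are close. Hence [phi] is at most [1 - b] at admissible midpoints,
    although it attains the norm at ['X^i]. *)
Lemma not_LD_condition_block_seminorm (delta : R) n :
  0 < delta <= 2 -> t n = 0 -> ~ LD_condition delta (block_seminorm t).
Proof.
move=> /andP[d0 d2] tn; set mu := block_seminorm t => cmu.
have [i _ bi] := block_unbounded n 0.
have mu0 q : 0 <= mu q := rat_seminorm_ge0 muS q.
pose rest (p : V) : V := p - p`_i *: 'X^i.
have restE p : rat_coef (rest p) = fun k => if k == i then 0 else rat_coef p k.
  apply/funext => k; rewrite /rat_coef coefB coefZ coefXn.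
  by case: eqP => [->|_]; rewrite ?mulr1 ?subrr ?rmorph0// mulr0 subr0.
pose phi (p : V) : R := weight i * rat_coef p i.
have w0 : 0 < weight i :> R := weight_gt0 i.
have split_mu p : mu p = `|phi p| + mu (rest p).
  pose m := maxn (size p) i.+1.
  have im : (i < m)%N by exact: leq_maxr.
  have pm : (size p <= m)%N by exact: leq_maxl.
  have rm : (size (rest p) <= m)%N.
    apply: leq_trans (size_polyD _ _) _; rewrite geq_max pm size_polyN.
    by apply: leq_trans (size_scale_leq _ _) _; rewrite size_polyXn.
  rewrite /mu (block_seminormE t pm) (block_seminormE t rm).
  rewrite (total_norm_split _ _ im) ?bi// restE /phi.
  by rewrite (normrM (weight i)) (gtr0_norm w0).
have phiD p q : phi (p + q) = phi p + phi q by rewrite /phi rat_coefD mulrDr.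
have phile p : phi p <= mu p.
  by rewrite split_mu; apply: le_trans (ler_norm _) _; rewrite lerDl.
have muX : mu 'X^i = weight i.
  rewrite split_mu /rest coefXn eqxx scale1r subrr /mu (rat_seminorm0 muS) addr0.
  by rewrite /phi /rat_coef coefXn eqxx rmorph1 mulr1 gtr0_norm.
(* Two points of the unit ball with [phi u + phi v > 2 * (1 - b)] are less than [4 * b = delta / 3]
   apart, while admissible pairs are more than [delta / 2] apart once [K <= delta / 2]. *)
pose b := delta / 12.
have [k0 hk0] := @invn_le R (delta / 2) ltac:(lra).
have bound e : 0 < e -> weight i <= (1 - b) * (weight i + e).
  move=> e0; have [k1 hk1] := invn_le e0.
  have [l [hl ltl]] := cmu (maxn k0 k1) 'X^i.
  have kk0 := le_trans (le_invn R (leq_maxl k0 k1)) hk0.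
  have kk1 := le_trans (le_invn R (leq_maxr k0 k1)) hk1.
  set K := _^-1 in hl ltl kk0 kk1.
  have : phi 'X^i <= (1 - b) * cost mu id l 'X^i.
    apply: (cost_functional_bound 'X^i phiD mu0 phile _ _ hl).
      by rewrite /b; lra.
    move=> u v mu1 mv1 uv; rewrite leNgt; apply/negP => h.
    have hu := phile u; have hv := phile v.
    have pu : `|phi u| = phi u by rewrite ger0_norm//; rewrite /b in h; lra.
    have pv : `|phi v| = phi v by rewrite ger0_norm//; rewrite /b in h; lra.
    have su := split_mu u; have sv := split_mu v; rewrite pu in su; rewrite pv in sv.
    have rB : rest (u - v) = rest u - rest v.
      by rewrite /rest coefB scalerBl !opprB addrACA [RHS]addrACA [X in _ + X]addrC.
    have suv := split_mu (u - v).
    have ruv : mu (rest (u - v)) <= mu (rest u) + mu (rest v).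
      by rewrite rB /mu -(rat_seminormN muS (rest v)); exact: muS.1.
    have puv : `|phi (u - v)| <= 2 * b.
      rewrite phiD (additiveN phiD) ler_norml; lra.
    by move: uv; rewrite suv /b in puv h *; lra.
  have -> : phi 'X^i = weight i.
    by rewrite /phi /rat_coef coefXn eqxx rmorph1 mulr1.
  move=> /le_trans; apply; apply: ler_wpM2l; first by rewrite /b; lra.
  by rewrite ltW//; apply: lt_le_trans ltl _; rewrite muX lerD2l.
(* With [e = b * weight i] the bound reads [weight i <= (1 - b ^ 2) * weight i], which is absurd. *)
have bw : 0 < b * weight i by rewrite mulr_gt0// /b; lra.
have := bound _ bw; have b1 : b <= 1 / 6 by rewrite /b; lra.
have bp : 0 < b by rewrite /b; lra.
by nra.
Qed.

End BlockSeminorm.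

(** * Membership in B *)

Section PointwiseLimits.
Context {R : realType}.

Lemma ptws_cvg (F : set_system (RV R)) (f : RV R) : Filter F ->
  (forall p, (fun g : RV R => g p) @ F --> f p) -> F --> f.
Proof.
move=> FF h; apply/cvg_sup => p A [B [[U oU <-] Uf] BA].
apply: filterS BA _; apply: h; exact: open_nbhs_nbhs.
Qed.

Lemma cvg_realmax (T : Type) (F : set_system T) (FF : Filter F)
    (f g : T -> R) (a b : R) :
  f x @[x --> F] --> a -> g x @[x --> F] --> b ->
  Num.max (f x) (g x) @[x --> F] --> Num.max a b.
Proof.
move=> fa gb; rewrite maxr_absE; under eq_fun do rewrite maxr_absE.
apply: cvgM; last exact: cvg_cst.
by apply: cvgD; [exact: cvgD|apply: cvg_norm; exact: cvgB].
Qed.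

Lemma cvg_ord_sum (T : Type) (F : set_system T) (FF : Filter F) (m : nat)
    (f : nat -> T -> R) (a : nat -> R) :
  (forall i, (i < m)%N -> f i x @[x --> F] --> a i) ->
  \sum_(i < m) f i x @[x --> F] --> \sum_(i < m) a i.
Proof.
elim: m => [|m IHm] h.
  by rewrite big_ord0; under eq_fun do rewrite big_ord0; exact: cvg_cst.
rewrite big_ord_recr/=; under eq_fun do rewrite big_ord_recr/=.
by apply: cvgD; [apply: IHm => i im; apply: h; rewrite ltnS ltnW|exact: h].
Qed.

(** Both arguments may vary: the coordinates for computing [mubar], the parameters for the
    continuity of the reduction. *)
Lemma cvg_total_norm (T : Type) (F : set_system T) (FF : Filter F) (m : nat)
    (tF aF : T -> nat -> R) (t a : nat -> R) :
  (forall n, tF x n @[x --> F] --> t n) ->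
  (forall i, aF x i @[x --> F] --> a i) ->
  total_norm (tF x) m (aF x) @[x --> F] --> total_norm t m a.
Proof.
move=> ht ha.
have hb n i : on_block n (aF x) i @[x --> F] --> on_block n a i.
  rewrite /on_block; case: ifP => _; last exact: cvg_cst.
  by apply: cvg_norm; exact: ha.
have hmax n k : running_max (on_block n (aF x)) k @[x --> F] -->
    running_max (on_block n a) k.
  by elim: k => [|k IHk] /=; [exact: cvg_cst|exact: cvg_realmax].
apply: (@cvg_ord_sum _ _ _ m (fun n x => block_norm (tF x) m n (aF x))
  (fun n => block_norm t m n a)) => n nm.
apply: cvg_realmax.
  apply: (@cvg_ord_sum _ _ _ m (fun i x => weight i * on_block n (aF x) i)
    (fun i => weight i * on_block n a i)) => i im.
  by apply: cvgM; [exact: cvg_cst|exact: hb].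
apply: cvgM; first exact: ht.
exact: hmax.
Qed.

End PointwiseLimits.

Section BlockSeminormBset.
Context {R : realType}.
Variable t : nat -> R.
Hypothesis t0 : forall n, 0 <= t n.

Let mu : RV R := block_seminorm t.

Lemma rat_approx (e a : R) : 0 < e -> exists q : rat, `|a - ratr q| <= e.
Proof.
move=> e0; have [q] : exists q, ratr q \in `]a - e, a + e[.
  by apply: rat_in_itvoo; lra.
by rewrite in_itv/= => /andP[q1 q2]; exists q; rewrite ler_norml; lra.
Qed.

(** The unit vectors are independent: rational approximations of a real relation have small norm,
    and this norm dominates every weighted coordinate. *)
Lemma block_seminorm_inf_dim (X : completeNormedModType R) (j : V -> X) :
  is_Xmu (block_seminorm t) j -> inf_dim X.
Proof.
move=> [jD jZ jmu _] n; exists (fun i : 'I_n => j 'X^i) => a suma i.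
have j0 : j 0 = 0 by apply: (addrI (j 0)); rewrite -jD !addr0.
have jsum (q : 'I_n -> rat) :
    j (\sum_k q k *: 'X^k) = \sum_k ratr (q k) *: j 'X^k.
  elim/big_rec2 : _ => // k x y _ <-; rewrite jD jZ //.
pose C := \sum_(k < n) `|j 'X^k|.
have C0 : 0 <= C by apply: sumr_ge0.
have w0 : 0 < weight i :> R := weight_gt0 i.
apply/eqP; rewrite -normr_le0 -(pmulr_rle0 _ w0).
apply/ler_addgt0Pr => e e0; rewrite add0r.
have D0 : 0 < C + weight i by rewrite ltr_wpDl.
pose e' := e / (C + weight i).
have e'0 : 0 < e' by rewrite divr_gt0.
have [q hq] := choice (fun k => rat_approx (a k) e'0).
have h1 : weight i * `|ratr (q i) : R| <= e' * C.
  have := weight_le_block_seminorm t (\sum_k q k *: 'X^k) i.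
  rewrite -jmu jsum /rat_coef coef_sum (bigD1 i)//= coefZ coefXn eqxx mulr1.
  rewrite big1 ?addr0 => [|k ki]; last first.
    rewrite coefZ coefXn (_ : (i == k :> nat) = false) ?mulr0//.
    by apply/negbTE; rewrite eq_sym.
  move=> /le_trans; apply.
  have -> : \sum_k ratr (q k) *: j 'X^k = \sum_k (ratr (q k) - a k) *: j 'X^k.
    under [RHS]eq_bigr do rewrite scalerBl.
    by rewrite sumrB suma subr0.
  rewrite mulr_sumr.
  apply: (le_trans (ler_norm_sum _ _ _)); apply: ler_sum => k _.
  by rewrite normrZ ler_wpM2r// distrC.
have h2 : weight i * `|a i| <= weight i * `|ratr (q i) : R| + weight i * e'.
  rewrite -mulrDr; apply: ler_wpM2l; first exact: ltW.
  rewrite -{1}(subrK (ratr (q i)) (a i)).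
  by apply: (le_trans (ler_normD _ _)); rewrite addrC lerD2l.
have : e' * (C + weight i) = e by rewrite /e' divfK// gt_eqF.
by lra.
Qed.

Lemma cvg_floor_approx (r : R) :
  (ratr ((Num.floor (r * n.+1%:R))%:~R / n.+1%:R : rat) : R) @[n --> \oo] --> r.
Proof.
apply/cvgrPdist_le => e e0; have [k hk] := invn_le e0.
near=> n; have kn : (k <= n)%N by near: n; exact: nbhs_infty_ge.
have n0 : 0 < n.+1%:R :> R by [].
apply: le_trans hk; apply: le_trans (le_invn R kn).
rewrite fmorph_div /= ratr_int ratr_nat.
have /andP[f1 f2] := floor_itv (r * n.+1%:R).
rewrite intrD in f2.
have -> : r - (Num.floor (r * n.+1%:R))%:~R / n.+1%:R =
    (r * n.+1%:R - (Num.floor (r * n.+1%:R))%:~R) / n.+1%:R.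
  by rewrite mulrBl mulfK// gt_eqF.
rewrite normrM normfV (gtr0_norm n0) ler_pdivrMr// mulVf ?gt_eqF//.
by rewrite ler_norml; lra.
Unshelve. all: by end_near. Qed.

Lemma mubar_block_seminorm (x : {poly R}) :
  mubar mu x = total_norm t (size x) (fun i => x`_i).
Proof.
apply: cvg_lim; first exact: Rhausdorff.
(* Approximants have size at most [size x], so one truncation serves for all [n]. *)
have E n : mu (Defs.approx n x) = total_norm t (size x) (rat_coef (Defs.approx n x)).
  apply: block_seminormE; rewrite /Defs.approx map_polyE.
  by apply: leq_trans (size_Poly _) _; rewrite size_map.
under eq_fun do rewrite E.
apply: cvg_total_norm => [n|i]; first exact: cvg_cst.
rewrite /rat_coef /Defs.approx.
under eq_fun do rewrite coef_map_id0 ?mul0r ?floor0 ?mul0r//.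
exact: cvg_floor_approx.
Qed.

Lemma block_seminorm_Bset : Bset mu.
Proof.
split; last first.
  move=> x; rewrite mubar_block_seminorm => x0; apply/polyP => i; rewrite coef0.
  have [ix|xi] := ltnP i (size x); last by rewrite nth_default.
  apply/eqP; rewrite -normr_le0 -(pmulr_rle0 _ (weight_gt0 i : 0 < weight i :> R)).
  by have := weight_le_total_norm t (fun i => x`_i) ix; rewrite x0.
split; first exact: block_seminorm_Pset.
exact: block_seminorm_inf_dim.
Qed.

End BlockSeminormBset.

(** * The reduction *)

Section ComplementDistance.
Context {R : realType} {Y : topologicalType}.
Variable d : Y -> Y -> R.
Hypothesis d_ge0 : forall x y, 0 <= d x y.
Hypothesis d0P : forall x y, d x y = 0 <-> x = y.
Hypothesis dC : forall x y, d x y = d y x.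
Hypothesis d_triangle : forall x y z, d x z <= d x y + d y z.
Hypothesis d_open : forall U : set Y, open U <->
  forall x, U x -> exists2 e : R, 0 < e & [set y | d x y < e] `<=` U.

(** The element 1 caps the distance and keeps the set nonempty when [U] is the whole space. *)
Definition complement_dist (U : set Y) (y : Y) : R :=
  inf (1 |` [set d y z | z in ~` U]).

Let complement_dist_lb U y : lbound (1 |` [set d y z | z in ~` U]) 0.
Proof. by move=> _ [->|[z _ <-]]. Qed.

Lemma complement_dist_le U y z : ~ U z -> complement_dist U y <= d y z.
Proof.
move=> Uz; apply: ge_inf; first by exists 0; exact: complement_dist_lb.
by right; exists z.
Qed.

Lemma complement_dist_le1 U y : complement_dist U y <= 1.
Proof. by apply: ge_inf; [exists 0; exact: complement_dist_lb|left]. Qed.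

Lemma le_complement_dist U y c :
  c <= 1 -> (forall z, ~ U z -> c <= d y z) -> c <= complement_dist U y.
Proof.
move=> c1 h; apply: lb_le_inf; first by exists 1; left.
by move=> _ [->|[z Uz <-]] //; exact: h.
Qed.

Lemma complement_dist_ge0 U y : 0 <= complement_dist U y.
Proof. by apply: le_complement_dist. Qed.

Lemma complement_dist_gt0 U y : open U -> 0 < complement_dist U y <-> U y.
Proof.
move=> oU; split=> [|Uy].
  apply: contraPP => Uy; apply/negP; rewrite -leNgt.
  by rewrite -((d0P y y).2 erefl); exact: complement_dist_le.
have [e e0 eU] := (d_open U).1 oU y Uy.
apply: (@lt_le_trans _ _ (Num.min 1 e)); first by rewrite lt_min ltr01.
apply: le_complement_dist; first by rewrite ge_min lexx.
move=> z Uz; rewrite ge_min; apply/orP; right; rewrite leNgt; apply/negP => h.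
by apply: Uz; exact: eU.
Qed.

Lemma complement_dist_continuous U : continuous (complement_dist U).
Proof.
move=> y; apply/cvgrPdist_lt => e e0.
(* The capped distance is 1-Lipschitz. *)
have lip x z : complement_dist U x <= complement_dist U z + d x z.
  rewrite -lerBlDr; apply: le_complement_dist.
    by have := complement_dist_le1 U x; have := d_ge0 x z; lra.
  move=> w Uw; have := complement_dist_le x Uw; have := d_triangle x z w; lra.
have : nbhs y [set z | d y z < e].
  apply: open_nbhs_nbhs; split; last by rewrite /= (d0P y y).2.
  apply/d_open => x /= yx; exists (e - d y x); first by rewrite subr_gt0.
  by move=> z /= xz; have := d_triangle y x z; lra.
apply: filterS => z /= yz.
by have := lip y z; have := lip z y; rewrite (dC z y) ltr_norml; lra.
Qed.

End ComplementDistance.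

Lemma block_seminorm_continuous (R : realType) (Y : topologicalType)
    (J : set (RV R)) (t : Y -> nat -> R) :
  (forall y, J (block_seminorm (t y))) ->
  (forall n, continuous (fun y => t y n)) ->
  continuous (fun y => block_seminorm (t y) : subspace J).
Proof.
move=> Jt ct y; apply/(@subspace_cvgP (RV R) J _ (block_seminorm (t y)) _ (Jt y)).
have cv : (fun z => block_seminorm (t z) : RV R) @ y --> (block_seminorm (t y) : RV R).
  apply: ptws_cvg => p.
  by apply: cvg_total_norm => [n|i]; [exact: ct|exact: cvg_cst].
move=> A /cv hA; apply: (@filterS _ (nbhs y) _ _ _ _ hA) => z h; exact: h (Jt z).
Qed.

Unset Implicit Arguments.

Theorem theorem5p3 (R : realType) (I : set (RV R)) :
  I = @Pset R \/ I = @Pinf R \/ I = @Bset R ->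
  forall delta : R, 0 < delta <= 2 ->
    Gdelta_complete R (I := I)
      ( [set mu : subspace I | I mu /\ Xmu_LDP delta mu]).
Proof.
move=> hI delta hdelta; have /andP[delta0 delta2] := hdelta.
have IP mu : I mu -> Pset mu by case: hI => [->|[|]->] // [] // [].
(* [Bset] is the smallest of the three classes, so one reduction with values in it serves all of
   them. *)
have BI mu : Bset mu -> I mu by case: hI => [->|[|]->] // [] // [].
have -> : [set mu : subspace I | I mu /\ Xmu_LDP delta mu] =
          [set mu : subspace I | I mu /\ LD_condition delta (mu : V -> R)].
  by apply/seteqP; split=> mu [Imu h]; split=> //;
    apply/(Xmu_LDP_condition delta0 (IP _ Imu)).
split; first exact: Gdelta_LD_condition.
move=> Y [_ [d [[d_ge0 d0P] dC d_triangle d_open _]]] _ B [F oF ->].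
(* All parameters are positive exactly when [y] lies in every [F n]; otherwise some parameter
   vanishes and the condition fails. *)
pose t y n := complement_dist d (F n) y.
have t0 y n : 0 <= t y n by exact: complement_dist_ge0.
have It y : I (block_seminorm (t y)) by apply: BI; exact: block_seminorm_Bset.
exists (fun y => block_seminorm (t y)); split => //.
  apply: block_seminorm_continuous => // n.
  exact: complement_dist_continuous.
apply/seteqP; split=> y /= hy.
  split => //; apply: LD_condition_block_seminorm => // n.
  by apply/(complement_dist_gt0 d_ge0 d0P d_open y (oF n)); exact: hy.
move=> n _; apply/(complement_dist_gt0 d_ge0 d0P d_open y (oF n)).
rewrite lt_neqAle t0 andbT eq_sym; apply/eqP => tn.
by apply: (not_LD_condition_block_seminorm (t0 y) hdelta tn hy.2).
Qed.
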